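(* Consider the generalized logistic equation $$u'(t)=g_0(t)u(t)\int_{\nu(t)}^t\left|1-\frac{u(s)}{\kappa}\right|^{\lambda}\operatorname{sgn}\left(1-\frac{u(s)}{\kappa}\right)d_sK(t,s),\qquad(\ast)$$ with $g_0,\nu,\kappa,\lambda,K,\mathcal{K}$ as in the context. Let $$\lim_{t\to-\infty}\int_t^{t_0}g_0(s)\,ds=+\infty,\qquad \lim_{t\to-\infty}\operatorname{ess\,inf}\{\mathcal{K}(s):s\le t\}>0.$$ Then, for every $t_0\in\mathbb{R}$ and $c\in(0,\kappa)$, there exists a positive global solution $u$ to $(\ast)$ such that $$u(t_0)=c,\qquad u(t)<\kappa\ \text{ for }t\le t_0,\qquad u'(t)\ge0\ \text{ for a.e. }t\le t_0,$$ and there exists a limit $u(-\infty)=0$. If, in addition, $\lim_{t\to+\infty}\operatorname{ess\,inf}\{\nu(s):s\ge t\}=+\infty$ and there exists a continuous function $\omega:\mathbb{R}\to\mathbb{R}$ with $\omega(t)\le t$ for all $t\in\mathbb{R}$ such that $$\lim_{t\to+\infty}\omega(t)=+\infty,\qquad\limsup_{t\to+\infty}\int_{\omega(t)}^tg_0(s)\mathcal{K}(s)\,ds>0,$$ then either $u$ oscillates about $\kappa$ in the neighbourhood of $+\infty$ or there exists a limit $u(+\infty)=\kappa$.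
   Context: $g_0:\mathbb{R}\to[0,+\infty)$ is locally Lebesgue integrable; $\nu:\mathbb{R}\to\mathbb{R}$ is a locally essentially bounded function with $\nu(t)\le t$ for a.e. $t\in\mathbb{R}$; $\kappa>0$, $\lambda>0$; $K:\mathbb{R}\times\mathbb{R}\to\mathbb{R}$ is a measurable function such that for a.e. $t\in\mathbb{R}$ the function $K(t,\cdot):\mathbb{R}\to\mathbb{R}$ is left continuous, nondecreasing and of locally bounded variation, and the function $\mathcal{K}(t)=\int_{\nu(t)}^td_sK(t,s)$ (defined for a.e. $t\in\mathbb{R}$) is essentially bounded and measurable. The integrals with respect to $d_sK(t,s)$ are Stieltjes integrals in $s$. The first hypothesis on $g_0$ (divergence of its integral at $-\infty$) does not depend on the choice of $t_0\in\mathbb{R}$. $\operatorname{sgn}$ is the sign function with $\operatorname{sgn}0=0$. A global solution is a function $u:\mathbb{R}\to\mathbb{R}$ absolutely continuous on every compact interval and satisfying the equation for a.e. $t\in\mathbb{R}$; it is positive if $u(t)>0$ for all $t\in\mathbb{R}$. $u(\pm\infty)$ denotes the limit of $u$ at $\pm\infty$. ''$u$ oscillates about $\kappa$ in the neighbourhood of $+\infty$'' means that there is no $\tau\in\mathbb{R}$ such that $u(t)\le\kappa$ for all $t\ge\tau$ or $u(t)\ge\kappa$ for all $t\ge\tau$. *)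

(* Defs.v *)
From HB Require Import structures.
From mathcomp Require Import all_boot all_order all_algebra.
From mathcomp Require Import all_classical all_reals all_analysis.
From mathcomp Require Import measurable_realfun ess_sup_inf.

Set Implicit Arguments.
Unset Strict Implicit.
Unset Printing Implicit Defensive.

Import Order.TTheory GRing.Theory Num.Theory.
Import numFieldNormedType.Exports.

Local Open Scope classical_set_scope.
Local Open Scope ring_scope.

(* The library's sigma-algebra on [R] is the Borel one.  Functions that are
   measurable in the sense of Lebesgue are the functions that are measurable
   for its completion with respect to the (product) Lebesgue measure. *)
Definition completion_measurable d (T : measurableType d) (R : realType)
    (mu : set T -> \bar R) (f : T -> R) : Prop :=
  measurable_fun [set: g_sigma_algebraType (completed_algebra_gen mu)]
    (f : g_sigma_algebraType (completed_algebra_gen mu) -> R).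

Definition lebesgue_measurable (R : realType) (f : R -> R) : Prop :=
  completion_measurable (@lebesgue_measure R) f.

Definition lebesgue_measurable2 (R : realType) (F : R -> R -> R) : Prop :=
  completion_measurable (@lebesgue_measure R \x @lebesgue_measure R)%E
    (fun p => F p.1 p.2).

(* [\int[mu]_(x in D) f x] is a difference of two suprema over Borel simple
   functions, and is insensitive to changes of [f] on null sets without any
   measurability assumption (see [ae_eq_integral_nonmeasurable] below).  As a
   [lebesgue_measurable] function is a.e. equal to a Borel one, the library's
   integral against [lebesgue_measure] is its Lebesgue integral. *)
Definition locally_lebesgue_integrable (R : realType) (f : R -> R) : Prop :=
  lebesgue_measurable f /\
  forall a b : R,
    (\int[@lebesgue_measure R]_(x in `[a, b]) `|f x|%:E < +oo)%E.

Definition ess_bounded (R : realType) (f : R -> R) : Prop :=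
  lebesgue_measurable f /\
  exists M : R, {ae @lebesgue_measure R, forall t, `|f t| <= M}.

Definition locally_ess_bounded (R : realType) (f : R -> R) : Prop :=
  lebesgue_measurable f /\
  forall a b : R, exists M : R,
    {ae @lebesgue_measure R, forall t, a <= t <= b -> `|f t| <= M}.

Definition left_continuous (R : realType) (G : R -> R) : Prop :=
  forall s : R, G x @[x --> s^'-] --> G s.

(* The measure of a left continuous nondecreasing [G] is determined by its
   values on the intervals [a, b[ ; the library's [lebesgue_stieltjes_measure]
   is for right continuous functions.  Junk value: the zero measure. *)
Definition is_stieltjes_measure (R : realType) (G : R -> R)
    (m : {measure set (measurableTypeR R) -> \bar R}) : Prop :=
  forall a b : R, a <= b -> m `[a, b[%classic = (G b - G a)%:E.

Definition stieltjes_measure (R : realType) (G : R -> R) :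
    {measure set (measurableTypeR R) -> \bar R} :=
  match pselect (exists m, is_stieltjes_measure G m) with
  | left exm => projT1 (cid exm)
  | right _ => mzero
  end.

(* The integral of [f] over [a, b] with respect to [dG], for [a <= b].  For a
   left continuous [G], integrating over [a, b[ gives the value of the
   Riemann-Stieltjes integral when [f] is continuous; in particular the
   integral of 1 is [G b - G a]. *)
Definition stieltjes_integral (R : realType) (G : R -> R) (a b : R)
    (f : R -> R) : R :=
  \int[stieltjes_measure G]_(s in `[a, b[) f s.

Definition kernel_mass (R : realType) (nu : R -> R) (K : R -> R -> R)
    (t : R) : R :=
  stieltjes_integral (K t) (nu t) t (fun=> 1).

Definition ess_inf_on (R : realType) (i : interval R) (f : R -> R) : \bar R :=
  ess_inf (mrestr (@lebesgue_measure R) (measurable_itv i)) (EFin \o f).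

(* The epsilon-delta definition, over finite families of nonoverlapping
   subintervals [l i, r i] of [a, b]. *)
Definition absolutely_continuous_on (R : realType) (a b : R) (u : R -> R) :
    Prop :=
  forall e : R, 0 < e -> exists2 d : R, 0 < d &
    forall (n : nat) (l r : 'I_n -> R),
      (forall i, [/\ a <= l i, l i <= r i & r i <= b]) ->
      (forall i j, i != j -> r i <= l j \/ r j <= l i) ->
      \sum_(i < n) (r i - l i) < d ->
      \sum_(i < n) `|u (r i) - u (l i)| < e.

Definition logistic_rhs (R : realType) (g0 nu : R -> R) (kappa lambda : R)
    (K : R -> R -> R) (u : R -> R) (t : R) : R :=
  g0 t * u t *
  stieltjes_integral (K t) (nu t) t
    (fun s => `|1 - u s / kappa| `^ lambda * Num.sg (1 - u s / kappa)).

Definition global_solution (R : realType) (g0 nu : R -> R) (kappa lambda : R)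
    (K : R -> R -> R) (u : R -> R) : Prop :=
  (forall a b : R, absolutely_continuous_on a b u) /\
  {ae @lebesgue_measure R, forall t,
     is_derive t (1 : R) u (logistic_rhs g0 nu kappa lambda K u t)}.

Definition positive_function (R : realType) (u : R -> R) : Prop :=
  forall t : R, 0 < u t.

Definition oscillates_about_at_pinfty (R : realType) (kappa : R)
    (u : R -> R) : Prop :=
  ~ exists tau : R,
      (forall t, tau <= t -> u t <= kappa) \/
      (forall t, tau <= t -> kappa <= u t).

Lemma stieltjes_measure_itv (R : realType) (G : R -> R) :
  {homo G : x y / x <= y} -> left_continuous G ->
  is_stieltjes_measure G (stieltjes_measure G).
Proof.
move=> ndG lcG; rewrite /stieltjes_measure; case: pselect => [exm|]; last first.
  case; pose F (s : R) : R := - G (- s).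
  have ndF : nondecreasing F by move=> x y xy; rewrite /F lerN2 ndG// lerN2.
  have rcF : right_continuous F.
    move=> x; apply: (@cvgN _ R^o).
    by have /cvg_at_leftNP := lcG (- x); rewrite opprK.
  pose hF := isCumulative.Build R _ R F ndF rcF.
  pose cF : cumulative R R := HB.pack F hF.
  have mN : measurable_fun [set: measurableTypeR R]
      (-%R : measurableTypeR R -> measurableTypeR R) by exact: oppr_measurable.
  pose m : {measure set (measurableTypeR R) -> \bar R} :=
    measure_function_pushforward__canonical__measure_function_Measure
      (lebesgue_stieltjes_measure cF) mN.
  exists m => a b ab; rewrite /= /m /pushforward opp_preimage_itvbndbnd/=.
  rewrite [LHS]measurable_mu_extE/=; last exact: is_ocitv.
  rewrite wlength_itv_bnd ?lerN2//=; congr EFin.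
  by rewrite /F !opprK addrC.
by case: cid.
Qed.

Import HBNNSimple.

Lemma ae_eq_integral_nonmeasurable d (T : measurableType d) (R : realType)
    (mu : {measure set T -> \bar R}) (D : set T) (f g : T -> \bar R) :
  {ae mu, forall x, D x -> f x = g x} ->
  (\int[mu]_(x in D) f x = \int[mu]_(x in D) g x)%E.
Proof.
move=> [N [mN N0 subN]].
suff le (h k : T -> \bar R) : (forall x, 0 <= h x)%E -> (forall x, 0 <= k x)%E ->
    (forall x, ~ N x -> h x = k x) -> (\int[mu]_x h x <= \int[mu]_x k x)%E.
  have eqN x : ~ N x -> (f \_ D) x = (g \_ D) x.
    move=> Nx; rewrite !patchE; case: ifPn => // /set_mem Dx.
    by apply: contrapT => fg; apply: Nx; apply: subN => /= /(_ Dx).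
  rewrite !(integral_mkcond D) integralE [RHS]integralE.
  by congr (_ - _)%E; apply/eqP; rewrite eq_le !le//= => x Nx;
    rewrite ?(funeposE, funenegE) eqN.
move=> h0 k0 hk; rewrite !ge0_integralTE//; apply: ge_ereal_sup => _ [s sh <-].
have mNC := measurableC mN.
apply: ereal_sup_ubound; exists (proj_nnsfun s mNC) => /=.
  move=> x; rewrite mindicE; case: (boolP (x \in ~` N)) => xN.
    by rewrite mulr1 -hk//; exact: set_mem xN.
  by rewrite mulr0 k0.
transitivity (\int[mu]_(x in ~` N) (s x)%:E)%E.
  by rewrite integral_nnsfun// mrestrict.
rewrite -setTD -ge0_negligible_integral// ?integral_nnsfun//; last 2 first.
- exact/measurable_EFinP.
- by move=> x _; rewrite lee_fin.
by rewrite patch_setT.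
Qed.

(* Main.v *)
Require Import Defs.
From mathcomp Require Import all_boot all_order all_algebra.
From mathcomp Require Import all_classical all_reals all_analysis.
From mathcomp Require Import measurable_realfun ess_sup_inf ring lra.

Set Implicit Arguments.
Unset Strict Implicit.
Unset Printing Implicit Defensive.

Import Order.TTheory GRing.Theory Num.Theory.
Import numFieldNormedType.Exports.

Local Open Scope classical_set_scope.
Local Open Scope ring_scope.

(** With [u = exp x] the equation reads
      x'(t) = g0(t) * (integral over [nu t, t[ of Phi(x(s)) d_sK(t, s)),
    where [Phi x = |1 - e^x / kappa|^lambda sgn (1 - e^x / kappa)] is continuous,
    nonincreasing, at most 1, and has the sign of [ln kappa - x].  Positivity of
    [u] is then automatic, and the task is to solve the integral equation
      x(t) = ln c + integral from t0 to t of the right-hand side ([rate]).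
    Let [C] bound the kernel mass; all moduli of continuity are measured with
    [clock], a primitive of [C g0].

    Before [t0] the equation is solved towards the past, and there its
    right-hand side is a monotone operator: raising [x] lowers [Phi x], hence
    the rate, hence raises the value reached at an earlier time.  The set of
    functions [y <= ln c] whose increments lie between 0 and those of [clock] is
    closed under suprema and preserved by the operator, so, as in Knaster-Tarski,
    the supremum of those [y] that lie below their image is a fixed point
    ([backward_solution]).  It is nondecreasing and below [ln c], so
    [Phi x >= Phi (ln c) > 0], and as the kernel mass is bounded below near
    -oo while the integral of [g0] diverges, [x] tends to -oo
    ([solution_cvgNy]).

    After [t0] the operator is antitone, and [Phi] need not be Lipschitz at
    [ln kappa].  Tonelli's approximations are used: in the right-hand side [x(s)]
    is replaced by [x(s - 1/(n+1))], which makes the equation explicit.  Since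
    [Phi <= 1], these approximations are bounded above on bounded intervals by
    one function, so [Phi] is bounded along them and they share a modulus of
    continuity.  A pointwise limit along an ultrafilter is then uniform on
    bounded intervals, and solves the equation ([forward_solution]).

    At +oo, suppose [x] stays on one side of [ln kappa].  As [nu] tends to +oo,
    [x] is monotone from some time on, so it converges.  If its limit were not
    [ln kappa], then [Phi x] would stay away from 0 and the integral of [g0]
    times the kernel mass over [a, b] would be at most a constant times
    [|x b - x a|], which is small for large [a]; this contradicts the
    hypothesis on [omega] ([monotone_tail_cvg], [delay_mass_tail]).

    What remains is the measurability of the rate.  Every function that is
    measurable for the completed sigma-algebra has a Borel version
    ([ae_measurable_completion]), so that one works with functions that are
    a.e. equal to a Borel one.  By Fubini almost every section [K(., s)] is such
    a function, left continuity extends this to all [s] and then to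
    [t |-> K(t, w(t))], and the integral against [d_sK(t, s)] is a limit of
    Riemann-Stieltjes sums ([ae_measurable_delay_integral]). *)

(** * Functions almost everywhere equal to a Borel function *)

Definition ae_measurable d (T : measurableType d) (R : realType)
    (mu : {measure set T -> \bar R}) (f : T -> R) : Prop :=
  exists2 h : T -> R, measurable_fun [set: T] h & {ae mu, forall x, f x = h x}.

Section ae_measurable_completion.
Context d (T : measurableType d) (R : realType).
Variable mu : {measure set T -> \bar R}.

Lemma ae_forall_countable (I : countType) (P : I -> T -> Prop) :
  (forall i, {ae mu, forall x, P i x}) -> {ae mu, forall x, forall i, P i x}.
Proof.
move=> aeP.
have /ae_foralln : forall n, {ae mu, forall x,
    if @unpickle I n is Some i then P i x else True}.
  by move=> n; case: unpickle => [i|]; [exact: aeP|exact: aeW].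
by apply: filterS => x Px i; have := Px (pickle i); rewrite pickleK.
Qed.

(** The sets that are a.e. equal to a measurable set form a sigma-algebra that
    contains the generators of the completion. *)
Lemma completion_measurable_set (A : set T) :
  (completed_algebra_gen mu).-sigma.-measurable A ->
  exists2 B, measurable B & {ae mu, forall x, A x <-> B x}.
Proof.
move=> mA; have := mA; rewrite /measurable/=.
suff : <<s completed_algebra_gen mu >> `<=`
    [set A | exists2 B, measurable B & {ae mu, forall x, A x <-> B x}].
  by move=> /(_ A).
apply: smallest_sub => /=; last first.
  move=> _ [/= B mB [N negN <-]]; exists B => //.
  apply: negligibleS negN => x /= nBN; apply: contrapT => Nx; apply: nBN.
  by split => [[//|]|Bx]; [|left].
split => /=.
- by exists set0; [exact: measurable0|exact: aeW].
- move=> G [B mB GB]; exists (~` B); first exact: measurableC.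
  apply: filterS GB => x GBx; split=> [[_ nG] /GBx//|nB].
  by split=> // /GBx.
- move=> F FB; pose B n := projT1 (cid2 (FB n)).
  exists (\bigcup_n B n).
    by apply: bigcupT_measurable => n; rewrite /B; case: cid2.
  have : forall n, {ae mu, forall x, F n x <-> B n x}.
    by move=> n; rewrite /B; case: cid2.
  move/ae_foralln; apply: filterS => x FBx.
  by split=> -[n _ Fn]; exists n => //; apply/FBx.
Qed.

(** The superlevel sets of [f] at rational heights are a.e. equal to measurable
    sets; off one null set, on which [f] may be replaced by 0, they are equal to
    them, and they determine all superlevel sets. *)
Lemma ae_measurable_completion (f : T -> R) :
  completion_measurable mu f -> ae_measurable mu f.
Proof.
move=> mf.
have fB (q : rat) : exists2 B, measurable B &
    {ae mu, forall x, ratr q < f x <-> B x}.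
  have [|B mB fB] := @completion_measurable_set (f @^-1` `]ratr q, +oo[).
    have := mf measurableT _ (@measurable_itv R `]ratr q, +oo[).
    by rewrite setTI.
  exists B => //; apply: filterS fB => x <-.
  by rewrite /= in_itv/= andbT.
pose B q := projT1 (cid2 (fB q)).
have mB q : measurable (B q) by rewrite /B; case: cid2.
have /ae_forall_countable[N [mN N0 subN]] :
    forall q, {ae mu, forall x, ratr q < f x <-> B q x}.
  by move=> q; rewrite /B; case: cid2.
have NB x : ~ N x -> forall q, ratr q < f x <-> B q x.
  by move=> Nx; apply: contrapT => /subN.
exists (f \_ (~` N)); last first.
  exists N; split => // x /= fx; apply: contrapT => Nx; apply: fx.
  by rewrite patchE mem_set.
apply: (measurability _ (RGenOInfty.measurableE R)) => // _ [_ [r ->] <-].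
rewrite setTI.
rewrite (_ : _ @^-1` _ = (~` N `&` \bigcup_(q : rat) (if r < ratr q then B q else set0))
   `|` (if r < 0 then N else set0)); last first.
  apply/seteqP; split => x /=; rewrite patchE in_itv/= andbT.
    case: ifPn => [/set_mem Nx rfx|]; last first.
      by rewrite notin_setE => /contrapT Nx ->; right.
    left; split => //.
    have [q] := rat_in_itvoo rfx; rewrite in_itv/= => /andP[rq qf].
    by exists q => //=; rewrite rq; apply/NB.
  move=> [[Nx [q _]]|]; last first.
    case: ifPn => // r0 Nx; rewrite ifF//.
    by apply/negbTE/negP => /set_mem; exact.
  case: ifPn => // rq /NB => /(_ Nx) qf.
  by rewrite mem_set//; exact: lt_trans qf.
apply: measurableU; last by case: ifP.
apply: measurableI; first exact: measurableC.
by apply: bigcupT_measurable_rat => q; case: ifP.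
Qed.

End ae_measurable_completion.

Section ae_measurable_theory.
Context d (T : measurableType d) (R : realType).
Variable mu : {measure set T -> \bar R}.
Implicit Types f g : T -> R.

Lemma ae_measurable_eq f g : {ae mu, forall x, f x = g x} ->
  ae_measurable mu g -> ae_measurable mu f.
Proof. by move=> fg [h mh gh]; exists h => //; apply: filterS2 fg gh => x ->. Qed.

Lemma measurable_ae_measurable f :
  measurable_fun [set: T] f -> ae_measurable mu f.
Proof. by move=> mf; exists f => //; exact: aeW. Qed.

Lemma ae_measurableD f g : ae_measurable mu f -> ae_measurable mu g ->
  ae_measurable mu (f \+ g).
Proof.
move=> [h mh fh] [k mk gk]; exists (h \+ k); first exact: measurable_funD.
by apply: filterS2 fh gk => x /= -> ->.
Qed.

Lemma ae_measurableB f g : ae_measurable mu f -> ae_measurable mu g ->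
  ae_measurable mu (f \- g).
Proof.
move=> [h mh fh] [k mk gk]; exists (h \- k); first exact: measurable_funB.
by apply: filterS2 fh gk => x /= -> ->.
Qed.

Lemma ae_measurableM f g : ae_measurable mu f -> ae_measurable mu g ->
  ae_measurable mu (f \* g).
Proof.
move=> [h mh fh] [k mk gk]; exists (h \* k); first exact: measurable_funM.
by apply: filterS2 fh gk => x /= -> ->.
Qed.

Lemma ae_measurable_sum (I : Type) (s : seq I) (f : I -> T -> R) :
  (forall i, ae_measurable mu (f i)) ->
  ae_measurable mu (fun x => \sum_(i <- s) f i x).
Proof.
move=> mf; elim: s => [|i s IHs].
  by under eq_fun do rewrite big_nil; exact: measurable_ae_measurable.
by under eq_fun do rewrite big_cons; exact: ae_measurableD.
Qed.

Lemma ae_measurable_cvg (f_ : nat -> T -> R) f :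
  (forall n, ae_measurable mu (f_ n)) ->
  {ae mu, forall x, f_ n x @[n --> \oo] --> f x} -> ae_measurable mu f.
Proof.
move=> mf_ cf; pose h n := projT1 (cid2 (mf_ n)).
have mh n : measurable_fun [set: T] (h n) by rewrite /h; case: cid2.
have fh : {ae mu, forall x, forall n, f_ n x = h n x}.
  by apply: ae_foralln => n; rewrite /h; case: cid2.
have [N [mN N0 subN]] : {ae mu, forall x, h n x @[n --> \oo] --> f x}.
  apply: filterS2 fh cf => x fhx; apply: cvg_trans.
  by apply: near_eq_cvg; apply: nearW => n; rewrite fhx.
have mNC := measurableC mN.
exists (f \_ (~` N)); last first.
  exists N; split => // x /= fx; apply: contrapT => Nx; apply: fx.
  by rewrite patchE mem_set.
apply/(measurable_restrictT _ mNC).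
apply: (@measurable_fun_cvg _ _ _ _ h) => [n|x Nx].
  exact: measurable_funTS.
by apply: contrapT => /subN.
Qed.

End ae_measurable_theory.

(** * Measurability of the Stieltjes integral in the parameter *)

#[global] Instance ae_lebesgue_filter (R : realType) :
  Filter (nbhs (almost_everywhere (@lebesgue_measure R))).
Proof. exact: (ae_filter_ringOfSetsType (@lebesgue_measure R)). Qed.

Section kernel_sections.
Context (R : realType).
Notation mu := (@lebesgue_measure R).

(** Countably many functions have Borel versions off a common null set, so a
    measurable countable choice among them can be made on the versions. *)
Lemma ae_measurable_glue d (T : measurableType d)
    (m : {measure set T -> \bar R}) (I : countType) (idx : T -> I)
    (f : I -> T -> R) :
  (forall i, measurable (idx @^-1` [set i])) ->
  (forall i, ae_measurable m (f i)) ->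
  ae_measurable m (fun x => f (idx x) x).
Proof.
move=> midx mf; pose h i := projT1 (cid2 (mf i)).
have mh i : measurable_fun [set: T] (h i) by rewrite /h; case: cid2.
have fh : {ae m, forall x, forall i, f i x = h i x}.
  by apply: ae_forall_countable => i; rewrite /h; case: cid2.
exists (fun x => h (idx x) x); last by apply: filterS fh => x ->.
move=> _ B mB; rewrite setTI.
rewrite (_ : _ @^-1` B = \bigcup_i (idx @^-1` [set i] `&` h i @^-1` B)).
  apply: countable_bigcupT_measurable => // i; apply: measurableI => //.
  by rewrite -[X in measurable X]setTI; exact: mh.
by apply/seteqP; split=> [x Bx|x [i _ [/= -> //]]]; exists (idx x).
Qed.

Lemma ae_ysection (N : set (R * R)) :
  measurable N -> (mu \x mu)%E N = 0%E ->
  {ae mu, forall s, mu (ysection N s) = 0%E}.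
Proof.
move=> mN; rewrite (@product_measure_unique _ _ _ _ _ mu mu (mu \x^ mu)%E)//; last first.
  by move=> A B mA mB; exact: product_measure2E.
rewrite /product_measure2 => N0.
have mf : measurable_fun [set: measurableTypeR R] (mu \o ysection N).
  exact: measurable_fun_ysection.
have [+ _] := ae_eq_integral_abs mu measurableT mf.
under eq_integral do rewrite gee0_abs//.
by move=> /(_ N0); apply: filterS => s; apply.
Qed.

Lemma ae_measurable_section (K : R -> R -> R) : lebesgue_measurable2 K ->
  {ae mu, forall s, ae_measurable mu (K ^~ s)}.
Proof.
move=> /ae_measurable_completion[H mH [N [mN N0 subN]]].
apply: filterS (ae_ysection mN N0) => s Ns0.
exists (fun t => H (t, s)).
  by apply: measurableT_comp => //; exact: measurable_fun_pair.
exists (ysection N s); split => //; first exact: measurable_ysection.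
by move=> t /= KH; apply/ysectionP/subN => /=.
Qed.

(** Sets of full measure are dense, which is how a property of almost every
    section reaches sections arbitrarily close from the left. *)
Lemma ae_meets_itv (P : R -> Prop) (a b : R) : a < b ->
  {ae mu, forall s, P s} -> exists2 s, a < s < b & P s.
Proof.
move=> ab [N [mN N0 subN]]; apply: contrapT => noP.
have : (mu `]a, b[%classic <= mu N)%E.
  apply: le_measure; rewrite ?inE//= => s /=.
  by rewrite in_itv/= => sab; apply: subN => /= Ps; apply: noP; exists s.
by rewrite N0 lebesgue_measure_itv/= lte_fin ab -EFinD lee_fin leNgt subr_gt0 ab.
Qed.

Lemma ae_measurable_section_left (K : R -> R -> R) (s : R) :
  lebesgue_measurable2 K ->
  {ae mu, forall t, left_continuous (K t)} -> ae_measurable mu (K ^~ s).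
Proof.
move=> /ae_measurable_section mK lcK.
have ex n : exists s', s - n.+1%:R^-1 < s' < s /\ ae_measurable mu (K ^~ s').
  have [|s' ss' ms'] := @ae_meets_itv _ (s - n.+1%:R^-1) s _ mK.
    by rewrite ltrBlDr ltrDl invr_gt0.
  by exists s'.
have /choice[v vP] := ex.
have vs : v n @[n --> \oo] --> s.
  apply: (@squeeze_cvgr _ _ _ _ (fun n => s - n.+1%:R^-1) (cst s)).
  - by apply: nearW => n; have [/andP[/ltW -> /ltW]] := vP n.
  - rewrite -[X in _ --> X]subr0; apply: cvgB; first exact: cvg_cst.
    exact: cvg_harmonic.
  - exact: cvg_cst.
apply: (ae_measurable_cvg (T := measurableTypeR R) (f_ := fun n => K ^~ (v n))) => [n|].
  by have [] := vP n.
apply: filterS lcK => t /(_ s)/cvg_at_leftP; apply; split=> // n.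
by have [/andP[]] := vP n.
Qed.

(** [K t (w t)] is the limit of [K t (z t)], where [z t] is the largest multiple
    of [1 / (n+1)] strictly below [w t]: strictness matters because only left
    continuity is available. *)
Lemma ae_measurable_comp_left (K : R -> R -> R) (w : R -> R) :
  lebesgue_measurable2 K ->
  {ae mu, forall t, left_continuous (K t)} ->
  ae_measurable mu w -> ae_measurable mu (fun t => K t (w t)).
Proof.
move=> mK lcK [v mv wv].
apply: (@ae_measurable_eq _ (measurableTypeR R) _ _ _ (fun t => K t (v t))).
  by apply: filterS wv => t ->.
pose idx n t : int := Num.ceil (n.+1%:R * v t) - 1.
pose z n (j : int) : R := j%:~R / n.+1%:R.
have zv n t : v t - n.+1%:R^-1 <= z n (idx n t) < v t.
  have /andP[] := ceil_itv (n.+1%:R * v t); rewrite -/(idx n t) => lo hi.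
  rewrite /z ltr_pdivrMr// [v t * _]mulrC lo andbT.
  rewrite ler_pdivlMr// mulrBl mulVf// mulrC lerBlDr.
  by rewrite -[X in _ + X]/(1%:~R) -intrD /idx subrK.
apply: (ae_measurable_cvg (T := measurableTypeR R) (f_ := fun n t => K t (z n (idx n t)))) => [n|].
  apply: (ae_measurable_glue (T := measurableTypeR R) (f := fun j t => K t (z n j))) => j; last first.
    exact: ae_measurable_section_left.
  rewrite (_ : _ @^-1` _ = v @^-1` `]z n j, z n (j + 1)]%classic).
    by rewrite -[X in measurable X]setTI; exact: mv.
  apply/seteqP; split=> t /=; rewrite in_itv/= /z ltr_pdivrMr// ler_pdivlMr//;
    rewrite [v t * _]mulrC.
    by move=> <-; rewrite /idx subrK ceil_itv.
  by move=> vj; rewrite /idx (@ceil_def _ _ (j + 1)) ?addrK.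
apply: filterS lcK => t /(_ (v t))/cvg_at_leftP; apply; split=> [n|].
  by have /andP[] := zv n t.
apply: (@squeeze_cvgr _ _ _ _ (fun n => v t - n.+1%:R^-1) (cst (v t))).
- by apply: nearW => n; have /andP[-> /ltW] := zv n t.
- rewrite -[X in _ --> X]subr0; apply: cvgB; first exact: cvg_cst.
  exact: cvg_harmonic.
- exact: cvg_cst.
Qed.

End kernel_sections.

Section continuous_on_segments.
Context (R : realType).
Implicit Types (psi : R -> R) (a b e : R).

(** Heine's theorem.  Only [x] is confined to the segment; [y] may lie slightly
    outside, which spares a bound on it. *)
Lemma continuous_unif_segment psi a b e : continuous psi -> 0 < e ->
  exists2 d, 0 < d &
    forall x y, a <= x <= b -> `|x - y| < d -> `|psi x - psi y| <= e.
Proof.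
move=> cpsi e0.
have cab : compact `[a, b]%classic by exact: segment_compact.
have /compact_near_coveringP cab' := cab.
have := cab' R (0^'+) (fun d x => forall y, `|x - y| < d -> `|psi x - psi y| <= e) _.
have cov x : `[a, b]%classic x -> \forall x' \near x & d \near 0^'+,
    forall y, `|x' - y| < d -> `|psi x' - psi y| <= e.
  move=> _.
  have e2 : 0 < e / 2 by rewrite divr_gt0.
  have /cvgrPdist_lt/(_ _ e2)[/= r r0 rP] := cpsi x.
  have r2r : r / 2 < r by rewrite ltr_pdivrMr// ltr_pMr// ltr1n.
  near=> x' d => y xyd.
  have xx' : `|x - x'| < r / 2.
    near: x'; apply: (@nbhsx_ballx R R x (r / 2)).
    by rewrite divr_gt0.
  have dr : d < r / 2 by near: d; apply: nbhs_right_lt; rewrite divr_gt0.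
  have h1 := rP x' (lt_trans xx' r2r).
  have h2 := rP y.
  rewrite -(subrK (psi x) (psi x')) -addrA.
  rewrite (le_trans (ler_normD _ _))// [e]splitr lerD//.
    by rewrite distrC ltW.
  rewrite ltW// h2//= -(subrK x' x) -addrA (le_lt_trans (ler_normD _ _))//.
  by rewrite [ltRHS]splitr ltrD// (lt_trans xyd).
move=> /(_ _ cov) covd.
near (0 : R)^'+ => d.
exists d => // x y xab xyd.
suff sub : `[a, b] `<=` (fun x => forall y, `|x - y| < d -> `|psi x - psi y| <= e).
  by apply: (sub x) => //=; rewrite in_itv.
by near: d.
Unshelve. all: by end_near. Qed.

Lemma continuous_bounded_segment psi a b : continuous psi ->
  exists M, forall x, a <= x <= b -> `|psi x| <= M.
Proof.
move=> cpsi; have [ab|ba] := leP a b; last first.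
  by exists 0 => x /andP[ax xb]; have := le_trans ax xb; rewrite leNgt ba.
have cn : {within `[a, b], continuous (fun x => `|psi x|)}.
  apply: continuous_subspaceT => x; apply: continuous_comp; first exact: cpsi.
  exact: norm_continuous.
have [c _ cP] := EVT_max ab cn.
by exists `|psi c| => x xab; apply: cP; rewrite in_itv.
Qed.

End continuous_on_segments.

Section stieltjes_integral_theory.
Context (R : realType) (G : R -> R).
Hypothesis ndG : {homo G : x y / x <= y}.
Hypothesis lcG : left_continuous G.
Implicit Types (psi : R -> R) (a b e : R).
Let m := stieltjes_measure G.

Let mE a b : a <= b -> m `[a, b[%classic = (G b - G a)%:E.
Proof. exact: stieltjes_measure_itv. Qed.

Lemma stieltjes_integrable psi a b : a <= b -> continuous psi ->
  m.-integrable `[a, b[ (EFin \o psi).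
Proof.
move=> ab cpsi; apply: measurable_bounded_integrable => //.
- by rewrite mE// ltry.
- apply: measurable_funTS; exact: continuous_measurable_fun.
- have [M MP] := continuous_bounded_segment a b cpsi.
  exists M; split; first exact: num_real.
  move=> M' MM' x /=; rewrite in_itv/= => /andP[ax xb].
  by rewrite (le_trans (MP _ _) (ltW MM'))// ax ltW.
Qed.

Lemma stieltjes_integral_cst a b (c : R) : a <= b ->
  stieltjes_integral G a b (fun=> c) = c * (G b - G a).
Proof. by move=> ab; rewrite /stieltjes_integral Rintegral_cst// mE. Qed.

Lemma le_stieltjes_integral psi1 psi2 a b : a <= b ->
  continuous psi1 -> continuous psi2 ->
  (forall s, a <= s < b -> psi1 s <= psi2 s) ->
  stieltjes_integral G a b psi1 <= stieltjes_integral G a b psi2.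
Proof.
move=> ab c1 c2 le12; apply: le_Rintegral => //; exact: stieltjes_integrable.
Qed.

(** Comparing each function with the other one plus [e] reduces the estimate to
    monotonicity and constants. *)
Lemma stieltjes_integral_dist psi1 psi2 a b e : a <= b ->
  continuous psi1 -> continuous psi2 ->
  (forall s, a <= s < b -> `|psi1 s - psi2 s| <= e) ->
  `|stieltjes_integral G a b psi1 - stieltjes_integral G a b psi2| <=
    e * (G b - G a).
Proof.
move=> ab c1 c2 le12.
have cD psi : continuous psi -> continuous (fun s => psi s + e).
  by move=> cpsi s; apply: cvgD; [exact: cpsi|exact: cvg_cst].
have D psi : continuous psi -> stieltjes_integral G a b (fun s => psi s + e) =
    stieltjes_integral G a b psi + e * (G b - G a).
  move=> cpsi; rewrite /stieltjes_integral RintegralD//; last 2 first.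
  - exact: stieltjes_integrable.
  - by apply: (@stieltjes_integrable (fun=> e)) => // s; exact: cvg_cst.
  by congr (_ + _); exact: stieltjes_integral_cst.
rewrite ler_distl lerBlDr -!D//; apply/andP; split;
  apply: le_stieltjes_integral => //; try exact: cD;
  by move=> s /le12; rewrite ler_distl lerBlDr => /andP[].
Qed.

Lemma stieltjes_integral_setU psi a b c : a <= b -> b <= c ->
  continuous psi -> stieltjes_integral G a c psi =
    stieltjes_integral G a b psi + stieltjes_integral G b c psi.
Proof.
move=> ab bc cpsi; rewrite /stieltjes_integral -Rintegral_setU//.
- congr Rintegral; rewrite -itv_bndbnd_setU//.
- rewrite -itv_bndbnd_setU//; apply: stieltjes_integrable => //.
  exact: le_trans bc.
- apply/disj_setPS => s [/=]; rewrite !in_itv/= => /andP[_ sb] /andP[].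
  by rewrite leNgt sb.
Qed.

Lemma stieltjes_integral_sum psi (p : nat -> R) n :
  (forall k, p k <= p k.+1) -> continuous psi ->
  stieltjes_integral G (p 0%N) (p n) psi =
  \sum_(k < n) stieltjes_integral G (p k) (p k.+1) psi.
Proof.
move=> ndp cpsi; elim: n => [|n IHn].
  rewrite big_ord0 /stieltjes_integral set_itv_ge ?Rintegral_set0//.
  by rewrite bnd_simp ltxx.
rewrite big_ord_recr/= -IHn; apply: stieltjes_integral_setU => //.
by elim: n {IHn} => // n /le_trans; apply.
Qed.

(** The subdivision into [n+1] equal parts, rather than an arbitrary one, keeps
    its points measurable functions of the endpoints. *)
Lemma stieltjes_integral_cvg psi a b : a <= b -> continuous psi ->
  let p n k := a + (b - a) * (k%:R / n.+1%:R) in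
  \sum_(k < n.+1) psi (p n k) * (G (p n k.+1) - G (p n k)) @[n --> \oo]
    --> stieltjes_integral G a b psi.
Proof.
move=> ab cpsi p.
have ndp n k : p n k <= p n k.+1.
  by rewrite lerD2l ler_wpM2l ?subr_ge0// ler_wpM2r// ler_nat.
have p0 n : p n 0%N = a by rewrite /p mul0r mulr0 addr0.
have pS n : p n n.+1 = b by rewrite /p divff// mulr1 addrC subrK.
have pab n k : (k <= n.+1)%N -> a <= p n k <= b.
  move=> kn; rewrite lerDl mulr_ge0 ?subr_ge0//= -lerBrDl.
  by rewrite ler_piMr ?subr_ge0// ler_pdivrMr// mul1r ler_nat.
apply/cvgrPdist_le => e e0.
pose e' := e / (G b - G a + 1).
have Gab : 0 <= G b - G a by rewrite subr_ge0 ndG.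
have e'0 : 0 < e' by rewrite divr_gt0// ltr_wpDl.
have [d d0 dP] := continuous_unif_segment a b cpsi e'0.
have : (b - a) * n.+1%:R^-1 @[n --> \oo] --> (b - a) * 0.
  by apply: cvgM; [exact: cvg_cst|exact: cvg_harmonic].
rewrite mulr0 => /cvgrPdist_lt/(_ d d0); apply: filterS => n.
rewrite sub0r normrN ger0_norm ?mulr_ge0 ?subr_ge0// => nd.
rewrite -{1}(p0 n) -{1}(pS n) stieltjes_integral_sum// -sumrB.
apply: (@le_trans _ _ (\sum_(k < n.+1) e' * (G (p n k.+1) - G (p n k)))).
  apply: (le_trans (ler_norm_sum _ _ _)); apply: ler_sum => k _.
  rewrite -stieltjes_integral_cst//.
  apply: stieltjes_integral_dist => // [s|s]; first exact: cvg_cst.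
  move=> /andP[ps sp]; rewrite distrC; apply: dP; first exact/pab/ltnW.
  rewrite distrC ger0_norm ?subr_ge0//; apply: le_lt_trans nd.
  rewrite lerBlDl (le_trans (ltW sp))// /p -addrA lerD2l -mulrDr.
  by rewrite ler_wpM2l ?subr_ge0// -[X in _ / _ + X]mul1r -mulrDl natr1.
rewrite -mulr_sumr -(big_mkord xpredT (fun k => G (p n k.+1) - G (p n k))).
rewrite telescope_sumr// p0 pS /e' -mulrA ler_piMr ?(ltW e0)//.
by rewrite mulrC ler_pdivrMr ?ltr_wpDl// mul1r lerDl.
Qed.

End stieltjes_integral_theory.

Section delay_measurability.
Context (R : realType) (nu : R -> R) (K : R -> R -> R).
Notation mu := (@lebesgue_measure R).
Hypothesis mnu : ae_measurable mu nu.
Hypothesis nu_le : {ae mu, forall t, nu t <= t}.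
Hypothesis mK : lebesgue_measurable2 K.
Hypothesis lcK : {ae mu, forall t, left_continuous (K t)}.
Hypothesis ndK : {ae mu, forall t, {homo K t : x y / x <= y}}.

Lemma ae_measurable_delay_integral (psi : R -> R) : continuous psi ->
  ae_measurable mu (fun t => stieltjes_integral (K t) (nu t) t psi).
Proof.
move=> cpsi.
pose p t n k := nu t + (t - nu t) * (k%:R / n.+1%:R).
have mp n k : ae_measurable mu (fun t => p t n k).
  apply: (ae_measurableD mnu).
  apply: (@ae_measurableM _ (measurableTypeR R) _ _ (fun t => t - nu t)
    (fun=> k%:R / n.+1%:R)).
    apply: (@ae_measurableB _ (measurableTypeR R) _ _ id) => //.
    exact: measurable_ae_measurable.
  exact: measurable_ae_measurable.
apply: (ae_measurable_cvg (T := measurableTypeR R) (f_ := fun n t =>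
  \sum_(k < n.+1) psi (p t n k) * (K t (p t n k.+1) - K t (p t n k)))).
  move=> n; apply: ae_measurable_sum => k; apply: ae_measurableM.
    have [h mh ph] := mp n k; exists (psi \o h).
      by apply: measurableT_comp => //; exact: continuous_measurable_fun.
    by apply: filterS ph => t /= ->.
  by apply: ae_measurableB; exact: ae_measurable_comp_left.
apply: filterS3 nu_le lcK ndK => t nut lct ndt.
exact: stieltjes_integral_cvg.
Qed.

End delay_measurability.

(** * Primitives of locally integrable functions *)

Section primitive.
Context (R : realType).
Notation mu := (@lebesgue_measure R).
Implicit Types (f g h : R -> R) (a b c k t : R).

(** Borel measurability is required only up to a null set, as the rate of the
    delay equation has no preferred Borel version. *)
Definition loc_integrable f : Prop := ae_measurable mu f /\
  forall a b, (\int[mu]_(x in `[a, b]) `|f x|%:E < +oo)%E.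

(** The oriented integral from 0 to [t]: of the two segments, one is empty or
    reduced to a point. *)
Definition primitive f t : R :=
  \int[mu]_(x in `[0, t]) f x - \int[mu]_(x in `[t, 0]) f x.

Lemma loc_integrable_borel f : loc_integrable f ->
  exists2 h, measurable_fun [set: R] h /\
             (forall a b, mu.-integrable `[a, b] (EFin \o h)) &
             {ae mu, forall t, f t = h t}.
Proof.
move=> [[h mh fh] fint]; exists h => //; split => // a b.
apply/integrableP; split; first exact/measurable_EFinP/measurable_funTS.
apply: le_lt_trans (fint a b); rewrite le_eqVlt; apply/predU1l.
by apply: ae_eq_integral_nonmeasurable; apply: filterS fh => t /= ->.
Qed.

Lemma Rintegral_ae_eq f g a b :
  {ae mu, forall t, a <= t <= b -> f t = g t} ->
  \int[mu]_(x in `[a, b]) f x = \int[mu]_(x in `[a, b]) g x.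
Proof.
move=> fg; congr fine; apply: ae_eq_integral_nonmeasurable.
by apply: filterS fg => t fgt /=; rewrite in_itv/= => /fgt ->.
Qed.

Lemma primitive_ae_eq f g : {ae mu, forall t, f t = g t} ->
  primitive f = primitive g.
Proof.
move=> fg; apply/funext => t; rewrite /primitive.
by congr (_ - _); apply: Rintegral_ae_eq; apply: filterS fg.
Qed.

Lemma primitiveB f a b : loc_integrable f -> a <= b ->
  primitive f b - primitive f a = \int[mu]_(x in `[a, b]) f x.
Proof.
move=> /loc_integrable_borel[h [mh inth] fh] ab.
rewrite (primitive_ae_eq fh) (@Rintegral_ae_eq f h)//; last first.
  by apply: filterS fh.
pose J x y := \int[mu]_(t in `[x, y]) h t.
have Jadd x y z : x <= y -> y <= z -> J x z = J x y + J y z.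
  move=> xy yz; apply/eqP; rewrite addrC -subr_eq /J Rintegral_itvB//.
  apply/eqP; apply: Rintegral_itv_obnd_cbnd.
  apply: integrableS (inth y z) => //; exact: subset_itv_oc_cc.
have Jge x y : y <= x -> J x y = 0.
  rewrite le_eqVlt => /predU1P[->|yx].
    by rewrite /J set_itv1 Rintegral_set1.
  by rewrite /J set_itv_ge ?Rintegral_set0// bnd_simp -ltNge.
change (J 0 b - J b 0 - (J 0 a - J a 0) = J a b).
have [b0|b0] := leP b 0.
  rewrite (Jge 0 b)// (Jge 0 a) ?(le_trans ab)// (Jadd a b 0)//.
  by rewrite !sub0r opprK addrC addrK.
have [a0|a0] := leP a 0.
  rewrite (Jge _ _ (ltW b0)) (Jge _ _ a0) (Jadd _ _ _ a0 (ltW b0)).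
  by rewrite subr0 sub0r opprK addrC.
rewrite (Jge _ _ (ltW b0)) (Jge _ _ (ltW a0)) (Jadd _ _ _ (ltW a0) ab).
by rewrite !subr0 addrAC subrr add0r.
Qed.

Lemma integral_primitive f a b : loc_integrable f -> a <= b ->
  (\int[mu]_(x in `[a, b]) (f x)%:E = (primitive f b - primitive f a)%:E)%E.
Proof.
move=> lf ab; rewrite primitiveB// /Rintegral fineK//.
have [h [mh inth] fh] := loc_integrable_borel lf.
have -> : (\int[mu]_(x in `[a, b]) (f x)%:E = \int[mu]_(x in `[a, b]) (h x)%:E)%E.
  by apply: ae_eq_integral_nonmeasurable; apply: filterS fh => t ->.
exact: integrable_fin_num.
Qed.

Lemma loc_integrableDZ f g k : loc_integrable f -> loc_integrable g ->
  loc_integrable (fun t => f t + k * g t).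
Proof.
move=> lf lg; split.
  apply: ae_measurableD; first exact: lf.1.
  apply: (@ae_measurableM _ (measurableTypeR R) _ _ (fun=> k)); last exact: lg.1.
  exact: measurable_ae_measurable.
move=> a b.
have [h1 [mh1 int1] fh] := loc_integrable_borel lf.
have [h2 [mh2 int2] gh] := loc_integrable_borel lg.
have /integrableP[_] : mu.-integrable `[a, b] (EFin \o (fun t => h1 t + k * h2 t)).
  rewrite (_ : _ \o _ = (EFin \o h1) \+ (fun t => k%:E * (EFin \o h2) t)%E)//.
  by apply: integrableD => //; exact: integrableZl.
apply: le_lt_trans; rewrite le_eqVlt; apply/predU1l.
by apply: ae_eq_integral_nonmeasurable; apply: filterS2 fh gh => t /= -> ->.
Qed.

Lemma loc_integrable0 : loc_integrable (fun=> 0).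
Proof.
split; first exact: measurable_ae_measurable.
by move=> a b; under eq_integral do rewrite normr0; rewrite integral0.
Qed.


Lemma loc_integrableZ f k : loc_integrable f -> loc_integrable (fun t => k * f t).
Proof.
move=> lf; have := loc_integrableDZ k loc_integrable0 lf.
rewrite (_ : (fun t => 0 + k * f t) = (fun t => k * f t) :> (R -> R))//.
by apply/funext => t; rewrite add0r.
Qed.

Lemma loc_integrable_bound f g : ae_measurable mu f -> loc_integrable g ->
  (forall a b, exists M,
    {ae mu, forall t, a <= t <= b -> `|f t| <= M * g t}) ->
  loc_integrable f.
Proof.
move=> mf lg fg; split=> // a b.
have [M fMg] := fg a b.
have [h mh fh] := mf.
have [h2 [mh2 inth2] gh] := loc_integrable_borel (loc_integrableZ M lg).
rewrite (_ : (\int[mu]_(x in `[a, b]) _)%E =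
             (\int[mu]_(x in `[a, b]) `|h x|%:E)%E); last first.
  by apply: ae_eq_integral_nonmeasurable; apply: filterS fh => t ->.
have /integrableP[_] := inth2 a b; apply: le_lt_trans.
apply: ae_ge0_le_integral => //.
- apply/measurable_EFinP; apply: measurableT_comp => //; exact: measurable_funTS.
- by apply: measurableT_comp => //; apply/measurable_EFinP; exact: measurable_funTS.
apply: filterS3 fMg fh gh => t fMg fht ght /=; rewrite in_itv/= => tab.
by rewrite lee_fin -fht -ght (le_trans (fMg tab))// ler_norm.
Qed.

Lemma primitiveDZ f g k t : loc_integrable f -> loc_integrable g ->
  primitive (fun x => f x + k * g x) t = primitive f t + k * primitive g t.
Proof.
move=> lf lg.
have [h1 [mh1 int1] fh] := loc_integrable_borel lf.
have [h2 [mh2 int2] gh] := loc_integrable_borel lg.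
rewrite (@primitive_ae_eq _ (fun x => h1 x + k * h2 x)); last first.
  by apply: filterS2 fh gh => x -> ->.
rewrite (primitive_ae_eq fh) (primitive_ae_eq gh) /primitive.
have E a b : \int[mu]_(x in `[a, b]) (h1 x + k * h2 x) =
    \int[mu]_(x in `[a, b]) h1 x + k * \int[mu]_(x in `[a, b]) h2 x.
  rewrite RintegralD// ?RintegralZl//.
  rewrite (_ : _ \o _ = (fun t => k%:E * (EFin \o h2) t)%E)//.
  exact: integrableZl.
rewrite !E; ring.
Qed.

Lemma primitive0 t : primitive (fun=> 0) t = 0.
Proof. by rewrite /primitive !Rintegral_cst// !mul0r subr0. Qed.

Lemma primitiveZ f k t : loc_integrable f ->
  primitive (fun x => k * f x) t = k * primitive f t.
Proof.
move=> lf; have := primitiveDZ k t loc_integrable0 lf.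
rewrite (_ : (fun t => 0 + k * f t) = (fun t => k * f t) :> (R -> R)).
  by rewrite primitive0 add0r.
by apply/funext => x; rewrite add0r.
Qed.

Lemma le_primitive f g a b : loc_integrable f -> loc_integrable g -> a <= b ->
  {ae mu, forall t, a <= t <= b -> f t <= g t} ->
  primitive f b - primitive f a <= primitive g b - primitive g a.
Proof.
move=> lf lg ab fg; rewrite !primitiveB//.
have [h1 [mh1 int1] fh] := loc_integrable_borel lf.
have [h2 [mh2 int2] gh] := loc_integrable_borel lg.
rewrite (@Rintegral_ae_eq f h1); last by apply: filterS fh.
rewrite (@Rintegral_ae_eq g (fun t => Num.max (h1 t) (h2 t))); last first.
  by apply: filterS3 fg fh gh => t /[swap] <- /[swap] <- fg /fg /max_r ->.
apply: le_Rintegral => //; last by move=> t _; rewrite le_max lexx.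
rewrite (_ : _ \o _ = (fun t => maxe (h1 t)%:E (h2 t)%:E)); last first.
  by apply/funext => t; rewrite /= EFin_max.
apply: (@le_integrable _ (measurableTypeR R) _ mu _ _ _
  (fun t => (`|h1 t| + `|h2 t|)%:E)) => //.
- by apply: measurable_maxe; apply/measurable_EFinP; exact: measurable_funTS.
- move=> t _ /=; rewrite -EFin_max lee_fin [leRHS]ger0_norm ?addr_ge0//.
  by rewrite maxEle; case: ifP => _; rewrite ?lerDl ?lerDr.
- rewrite (_ : (fun t => _) = (EFin \o (Num.norm \o h1)) \+ (EFin \o (Num.norm \o h2)))%E//.
  by apply: integrableD => //; exact: integrable_norm.
Qed.

(** Candidate solutions are compared through this: an a.e. bound between rates
    becomes a bound between increments. *)
Lemma primitive_dist f1 f2 g k a b : loc_integrable f1 -> loc_integrable f2 ->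
  loc_integrable g -> a <= b ->
  {ae mu, forall t, a <= t <= b -> `|f1 t - f2 t| <= k * g t} ->
  `|(primitive f1 b - primitive f1 a) - (primitive f2 b - primitive f2 a)| <=
    k * (primitive g b - primitive g a).
Proof.
move=> l1 l2 lg ab fg.
have E f : loc_integrable f ->
    primitive (fun x => f x + k * g x) b - primitive (fun x => f x + k * g x) a =
    primitive f b - primitive f a + k * (primitive g b - primitive g a).
  by move=> lf; rewrite !primitiveDZ//; ring.
rewrite ler_distl lerBlDr -!E//; apply/andP; split;
  apply: le_primitive => //; try exact: loc_integrableDZ;
  by apply: filterS fg => t + tab => /(_ tab); rewrite ler_distl lerBlDr => /andP[].
Qed.

Lemma primitive_nondecreasing f a b : loc_integrable f ->
  {ae mu, forall t, a <= t <= b -> 0 <= f t} -> a <= b ->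
  primitive f a <= primitive f b.
Proof.
move=> lf f0 ab; rewrite -subr_ge0.
have := le_primitive loc_integrable0 lf ab f0.
by rewrite !primitive0 subrr.
Qed.

(** The open intervals are disjoint, so the sum of the increments is an
    integral over their union, to which the absolute continuity of the integral
    of [|f|] over [a, b] applies. *)
Lemma primitive_ac f a b : loc_integrable f ->
  absolutely_continuous_on a b (primitive f).
Proof.
move=> lf e e0.
have [h [mh inth] fh] := loc_integrable_borel lf.
have inthab : mu.-integrable [set: R] (EFin \o (h \_ `[a, b])).
  by rewrite -restrict_EFin; apply/integrable_restrict => //=; rewrite setTI.
have [d [d0 dP]] := integral_normr_continuous inthab e0.
exists d => // n l r lr disj ltd.
pose F i : set R := `]l i, r i[%classic.
have tF : trivIset setT F.
  apply/trivIsetP => i j _ _ ij; rewrite -subset0 => x [].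
  rewrite /F /= !in_itv/= => /andP[lix xri] /andP[ljx xrj].
  have [h1|h1] := disj i j ij.
    by have := lt_trans ljx (lt_le_trans xri h1); rewrite ltxx.
  by have := lt_trans lix (lt_le_trans xrj h1); rewrite ltxx.
pose U := \big[setU/set0]_(i < n) F i.
have mU : measurable U.
  by apply: bigsetU_measurable => i _; exact: measurable_itv.
have muU : (mu U < d%:E)%E.
  rewrite /U measure_bigsetU_ord//; last by move=> i; exact: measurable_itv.
  rewrite (eq_bigr (fun i => (r i - l i)%:E)) ?sumEFin ?lte_fin// => i _.
  have [_ lri _] := lr i.
  transitivity (mu (F i)) => //.
  rewrite /F lebesgue_measure_itv/= lte_fin; move: lri; rewrite le_eqVlt => /predU1P[->|->//].
  by rewrite ltxx subrr.
apply: le_lt_trans (dP U mU muU).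
rewrite /Rintegral /U ge0_integral_bigsetU//=; first last.
- apply/measurable_EFinP/measurable_funTS; apply: measurableT_comp => //.
  by case/integrableP : inthab => /measurable_EFinP.
- exact: sub_trivIset tF.
- exact: index_enum_uniq.
- by move=> i; exact: measurable_itv.
have inti i : mu.-integrable (F i) (EFin \o (h \_ `[a, b])).
  by apply: integrableS inthab => //; exact: measurable_itv.
rewrite -sum_fine => [|i _]; last first.
  apply: integrable_fin_num; first exact: measurable_itv.
  exact: (integrable_norm (inti i)).
apply: ler_sum => i _; have [ali lri rib] := lr i.
rewrite primitiveB// (@Rintegral_ae_eq f h); last by apply: filterS fh.
rewrite -Rintegral_itv_obnd_cbnd; last first.
  by apply: integrableS (inth (l i) (r i)) => //; exact: subset_itv_oc_cc.
rewrite -Rintegral_itv_bndo_bndc; last first.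
  by apply: integrableS (inth (l i) (r i)) => //; exact: subset_itv_oo_cc.
have -> : \int[mu]_(x in `]l i, r i[) h x = \int[mu]_(x in F i) (h \_ `[a, b]) x.
  apply: eq_Rintegral => x; rewrite inE/= in_itv/= => /andP[lx xr].
  rewrite patchE mem_set//= in_itv/= (le_trans ali (ltW lx)).
  exact: le_trans (ltW xr) rib.
apply: (le_normr_Rintegral _ (inti i)); exact: measurable_itv.
Qed.

Lemma ac_continuous f : (forall a b, absolutely_continuous_on a b f) ->
  continuous f.
Proof.
move=> acf t; apply/cvgrPdist_lt => e e0.
have [d d0 dP] := acf (t - 1) (t + 1) e e0.
near=> s.
have st1 : `|t - s| < 1 by near: s; exact: (@nbhsx_ballx R R t 1).
have std : `|t - s| < d by near: s; exact: (@nbhsx_ballx R R t d).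
have {dP} := dP 1%N (fun=> Num.min t s) (fun=> Num.max t s).
move: st1; rewrite ltr_distlC => /andP[t1s st1].
rewrite !big_ord1 maxEle minEle; case: ifPn => ts; [rewrite distrC|]; apply.
- by move=> _; split=> //; lra.
- by move=> i j; rewrite !ord1 eqxx.
- by rewrite distrC ger0_norm ?subr_ge0// in std.
- by move=> _; move: ts; rewrite -ltNge => ts; split; lra.
- by move=> i j; rewrite !ord1 eqxx.
- move: ts; rewrite -ltNge => /ltW ts.
  by rewrite ger0_norm ?subr_ge0// in std.
Unshelve. all: by end_near. Qed.

Lemma primitive_continuous f : loc_integrable f -> continuous (primitive f).
Proof. by move=> lf; apply: ac_continuous => a b; exact: primitive_ac. Qed.

(** Lebesgue's differentiation theorem on each half-line ]-n, +oo[, where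
    [primitive f] differs from the integral from [-n] by a constant. *)
Lemma primitive_derive f : loc_integrable f ->
  {ae mu, forall t, is_derive t (1 : R) (primitive f) (f t)}.
Proof.
move=> lf; have [h [mh inth] fh] := loc_integrable_borel lf.
have loch : locally_integrable [set: R] h.
  split=> //; first exact: openT.
  move=> A _ cA; have [M [_ MA]] := compact_bounded cA.
  have /integrableP[_] := inth (- (M + 1)) (M + 1); apply: le_lt_trans.
  apply: ge0_subset_integral => //=; first exact: compact_measurable.
    by apply/measurable_EFinP; apply: measurableT_comp => //; exact: measurable_funTS.
  move=> x Ax /=; rewrite in_itv/= -ler_norml; apply: MA => //.
  by rewrite ltrDl.
have : forall n : nat, {ae mu, forall t, - n%:R < t ->
    is_derive t (1 : R) (primitive h) (h t)}.
  move=> n; have := @FTC1 R h (BLeft (- n%:R)) (fun y => inth _ y) loch.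
  apply: filterS => t Ft nt.
  have {Ft}[|dF F'] := Ft; first by rewrite lte_fin.
  pose F y := \int[mu]_(x in `[- n%:R, y]) h x + primitive h (- n%:R).
  have E : \forall y \near t, F y = primitive h y.
    near=> y.
    rewrite /F -primitiveB ?subrK//.
      split; first exact: measurable_ae_measurable.
      by move=> a b; have /integrableP[] := inth a b.
    by apply: ltW; near: y; exact: lt_nbhsr.
  apply: (@near_eq_is_derive _ R^o R^o F _ _ _ _ E).
  rewrite -[h t]addr0; apply: is_deriveD.
  by rewrite -F' derive1E; exact: DeriveDef.
move=> /ae_foralln Dh; apply: filterS2 (fh) Dh => t ft Dt.
rewrite (primitive_ae_eq fh) ft.
apply: (Dt (Num.truncn `|t|).+1).
by rewrite ltrNl (le_lt_trans (ler_norm _))// normrN truncnS_gt.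
Unshelve. all: by end_near. Qed.

End primitive.

(** * Increments and limits of real functions *)

Section increments.
Context (R : realType).
Implicit Types a b c d e : R.

Lemma addl_increment a b c : a + b - (a + c) = b - c.
Proof. by ring. Qed.

Lemma shifted_increment a b c d : a + (b - c) - (a + (d - c)) = b - d.
Proof. by ring. Qed.

Lemma paired_increment a b c d e : a + (b - c) - (d + (e - c)) = (a - d) + (b - e).
Proof. by ring. Qed.

Lemma increment_split a b c d a' b' c' : a + b = c + d -> a' + b' = c' + d ->
  c - c' = (a - a') + (b - b').
Proof. by lra. Qed.

Lemma dist_chain a b c d e r : `|a - b| <= r / 4 -> `|b - c| < r / 4 ->
  `|c - d| <= r / 4 -> `|d - e| <= r / 4 -> `|a - e| < r.
Proof.
move=> ab bc cd de; apply: (le_lt_trans (ler_distD b _ _)).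
have := ler_distD c b e; have := ler_distD d c e; lra.
Qed.

End increments.

Lemma modulus_continuous (R : realType) (A y : R -> R) : continuous A ->
  (forall T, exists M, forall s t, s <= t -> t <= T ->
    `|y t - y s| <= M * (A t - A s)) -> continuous y.
Proof.
move=> cA mody t; have [M MP] := mody (t + 1).
have cMA : (fun s => `|M * (A t - A s)|) @ t --> (0 : R).
  rewrite -[X in _ --> X](normr0 R^o) -[X in `|X|](mulr0 M) -[X in M * X](subrr (A t)).
  apply: cvg_norm; apply: cvgM; first exact: cvg_cst.
  by apply: cvgB; [exact: cvg_cst|exact: cA].
apply/cvgrPdist_le => e e0.
move: cMA => /cvgrPdist_le/(_ e e0) near1.
near=> s.
have : `|M * (A t - A s)| <= e.
  suff : `|0 - `|M * (A t - A s)| | <= e by rewrite sub0r normrN normr_id.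
  by near: s.
apply: le_trans; have : `|t - s| < 1 by near: s; exact: (@nbhsx_ballx R R t 1).
rewrite ltr_distlC => /andP[_ st1].
have [ts|/ltW st] := leP t s.
  rewrite distrC (le_trans (MP _ _ ts (ltW st1)))// -[A s - _]opprB mulrN.
  by rewrite -normrN ler_norm.
by rewrite (le_trans (MP _ _ st _)) ?ler_norm// lerDl.
Unshelve. all: by end_near. Qed.

(** The limit along an ultrafilter finer than [n --> oo], taken separately at
    each point: approximation holds on a set of the ultrafilter at each point,
    hence simultaneously at finitely many points. *)
Lemma bounded_seq_limit_point (R : realType) (f_ : nat -> R -> R) (b : R -> R) :
  (forall n t, `|f_ n t| <= b t) ->
  exists f : R -> R, forall (s : seq R) (e : R) (N : nat), 0 < e ->
    exists2 n, (N <= n)%N & forall t, t \in s -> `|f_ n t - f t| < e.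
Proof.
move=> fb; have [F [UF ooF]] := ultraFilterLemma (eventually_filter).
have limF t : exists l : R, forall e, 0 < e -> F [set n | `|f_ n t - l| < e].
  have cb : compact `[- b t, b t]%classic by exact: segment_compact.
  have [|l [_ Fl]] := cb (fmap (f_ ^~ t) F) _.
    rewrite /fmap/=; apply: (@filterE _ F) => n /=.
    by rewrite in_itv/= -ler_norml.
  exists l => e e0.
  have [//|FC] := in_ultra_setVsetC [set n | `|f_ n t - l| < e] UF.
  have [p [/= ple lpe]] := Fl [set p | ~ `|p - l| < e] _ FC (nbhsx_ballx l e e0).
  by exfalso; apply: ple; rewrite distrC.
have [f fP] := choice limF; exists f => s e N e0.
have : F [set n | (N <= n)%N /\ forall t, t \in s -> `|f_ n t - f t| < e].
  apply: filterI; first by apply: ooF; exists N.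
  elim: s => [|t s IHs]; first by apply: filterE.
  apply: filterS2 (fP t e e0) IHs => n nt ns t'.
  by rewrite inE => /predU1P[->|/ns].
by move=> /filter_ex[n [Nn ns]]; exists n.
Qed.

Lemma finite_net (R : realType) (a b d : R) : 0 < d -> exists s : seq R,
  forall t, a <= t <= b -> exists2 q, q \in s & a <= q <= t /\ t - q < d.
Proof.
move=> d0; exists [seq a + k%:R * d | k <- iota 0 (Num.truncn ((b - a) / d)).+1].
move=> t /andP[at_ tb]; pose k := Num.truncn ((t - a) / d).
have ta0 : 0 <= (t - a) / d by rewrite divr_ge0 ?subr_ge0// ltW.
have /andP[k1 k2] := truncn_itv ta0.
exists (a + k%:R * d).
  apply/mapP; exists k => //; rewrite mem_iota/= add0n ltnS; apply: le_truncn.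
  by rewrite ler_pM2r ?invr_gt0// lerD2r.
rewrite ler_pdivlMr// in k1; rewrite ltr_pdivrMr// in k2.
split; first by rewrite lerDl mulr_ge0 ?(ltW d0)//= -lerBrDl.
by rewrite opprD addrA ltrBlDr (lt_le_trans k2)// -natr1 mulrDl mul1r addrC.
Qed.

(** [z] is monotone and bounded, so its increments far away are small; if [z]
    kept a distance to [B], these increments would control those of [W], which
    do not become small. *)
Lemma monotone_tail_cvg (R : realType) (z W : R -> R) (B N : R) :
  (forall t, N <= t -> z t <= B) ->
  (forall s t, N <= s -> s <= t -> z s <= z t) ->
  (forall e, 0 < e -> (forall t, N <= t -> z t <= B - e) ->
     exists2 d, 0 < d & exists T, forall a b, T <= a -> a <= b ->
       d * (W b - W a) <= z b - z a) ->
  ~ (forall e, 0 < e -> exists T, forall a b, T <= a -> a <= b -> W b - W a <= e) ->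
  z t @[t --> +oo] --> B.
Proof.
move=> zB ndz zW nW; apply/cvgrPdist_le => e e0.
have [T NT zT] : exists2 T, N <= T & B - e < z T.
  apply: contrapT => noT; apply: nW => r r0.
  have [|d d0 [T dT]] := zW _ e0.
    by move=> t Nt; rewrite leNgt; apply/negP => zt; apply: noT; exists t.
  pose T1 := Num.max N T; pose A := [set z t | t in [set t | T1 <= t]].
  have hA : has_sup A.
    split; first by exists (z T1); exists T1 => //=.
    by exists B => _ [t /= T1t <-]; apply: zB; apply: le_trans T1t; rewrite le_max lexx.
  have [_ [T2 /= T12 <-] zT2] := sup_adherent (mulr_gt0 d0 r0) hA.
  exists T2 => a b T2a ab; rewrite -(ler_pM2l d0); apply: le_trans (dT _ _ _ ab) _.
    by rewrite (le_trans _ T2a)// (le_trans _ T12)// le_max lexx orbT.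
  have : z b <= sup A.
    by apply: sup_upper_bound => //; exists b => //=; rewrite (le_trans T12) ?(le_trans T2a).
  have : z T2 <= z a.
    by apply: ndz => //; apply: le_trans T12; rewrite le_max lexx.
  by move: zT2; lra.
near=> t; have Tt : T <= t by near: t; exact: nbhs_pinfty_ge (num_real _).
have := ndz _ _ NT Tt; have := zB t (le_trans NT Tt).
by move=> h1 h2; rewrite ger0_norm; lra.
Unshelve. all: by end_near. Qed.

(** * The delay equation [x' = g * Itg (Phi o x)] *)

(** What is used of [Itg psi t], the integral of [psi] over [nu t, t[ against
    the kernel at time [t]; [m t] is its total mass. *)
Record delay_functional (R : realType) (nu m : R -> R) (C : R)
    (Itg : (R -> R) -> R -> R) : Prop := DelayFunctional {
  delay_bound_gt0 : 0 < C ;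
  delay_locally_bounded : forall a b, exists N,
    {ae @lebesgue_measure R, forall t, a <= t <= b -> N <= nu t} ;
  delay_measurable : forall psi : R -> R, continuous psi ->
    ae_measurable (@lebesgue_measure R) (Itg psi) ;
  delay_le : {ae @lebesgue_measure R, forall t, forall psi1 psi2 : R -> R,
    continuous psi1 -> continuous psi2 ->
    (forall s, nu t <= s < t -> psi1 s <= psi2 s) -> Itg psi1 t <= Itg psi2 t} ;
  delay_dist : {ae @lebesgue_measure R, forall t,
    forall (psi1 psi2 : R -> R) (e : R),
    continuous psi1 -> continuous psi2 -> 0 <= e ->
    (forall s, nu t <= s < t -> `|psi1 s - psi2 s| <= e) ->
    `|Itg psi1 t - Itg psi2 t| <= e * C} ;
  delay_cst : {ae @lebesgue_measure R, forall t,
    forall c, Itg (fun=> c) t = c * m t} ;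
  delay_mass_le : {ae @lebesgue_measure R, forall t, m t <= C} }.

Record response_law (R : realType) (Phi : R -> R) : Prop := ResponseLaw {
  response_law_continuous : continuous Phi ;
  response_law_le : {homo Phi : x y / x <= y >-> y <= x} ;
  response_law_le1 : forall x, Phi x <= 1 }.

Section delay_equation.
Context (R : realType).
Notation mu := (@lebesgue_measure R).
Variables (nu m g : R -> R) (C : R) (Itg : (R -> R) -> R -> R).
Hypothesis lg : loc_integrable g.
Hypothesis g0 : forall t, 0 <= g t.
Hypothesis HI : delay_functional nu m C Itg.
Variable Phi : R -> R.
Hypothesis HPhi : response_law Phi.

Let C0 : 0 < C. Proof. by case: HI. Qed.
Let nuB a b : exists N, {ae mu, forall t, a <= t <= b -> N <= nu t}.
Proof. by case: HI. Qed.
Let mItg (psi : R -> R) : continuous psi -> ae_measurable mu (Itg psi).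
Proof. by case: HI => ? ? h ? ? ? ?; exact: h. Qed.
Let Itg_le : {ae mu, forall t, forall psi1 psi2 : R -> R,
  continuous psi1 -> continuous psi2 ->
  (forall s, nu t <= s < t -> psi1 s <= psi2 s) -> Itg psi1 t <= Itg psi2 t}.
Proof. by case: HI. Qed.
Let Itg_dist : {ae mu, forall t, forall (psi1 psi2 : R -> R) (e : R),
  continuous psi1 -> continuous psi2 -> 0 <= e ->
  (forall s, nu t <= s < t -> `|psi1 s - psi2 s| <= e) ->
  `|Itg psi1 t - Itg psi2 t| <= e * C}.
Proof. by case: HI. Qed.
Let Itg_cst : {ae mu, forall t, forall c, Itg (fun=> c) t = c * m t}.
Proof. by case: HI. Qed.
Let mC : {ae mu, forall t, m t <= C}. Proof. by case: HI. Qed.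
Let cPhi : continuous Phi. Proof. by case: HPhi. Qed.
Let Phi_le : {homo Phi : x y / x <= y >-> y <= x}. Proof. by case: HPhi. Qed.
Let Phi1 x : Phi x <= 1. Proof. by case: HPhi. Qed.

Definition rate (y : R -> R) t := g t * Itg (Phi \o y) t.

(** Since [m <= C] and [Phi <= 1], the increments of a solution are at most
    those of [clock]. *)
Definition clock := primitive (fun t => C * g t).

Let lCg : loc_integrable (fun t => C * g t). Proof. exact: loc_integrableZ. Qed.

Lemma clock_continuous : continuous clock.
Proof. exact: primitive_continuous. Qed.

Lemma clock_le a b : a <= b -> clock a <= clock b.
Proof.
apply: primitive_nondecreasing => //.
by apply: aeW => t _; rewrite mulr_ge0// ltW.
Qed.

(** Stopping at [t0] does not increase the increments of [clock]. *)
Lemma clock_min t0 s t : s <= t ->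
  0 <= clock (Num.min t t0) - clock (Num.min s t0) <= clock t - clock s.
Proof.
move=> st; rewrite subr_ge0 clock_le ?le_min ?ge_min ?st ?lexx ?orbT//=.
have [tt0|/ltW t0t] := leP t t0.
  by rewrite min_l// (le_trans st tt0).
have [st0|/ltW t0s] := leP s t0.
  by rewrite lerB// clock_le.
by rewrite subrr subr_ge0 clock_le.
Qed.

Lemma comp_Phi (y : R -> R) : continuous y -> continuous (Phi \o y).
Proof. by move=> cy t; apply: continuous_comp; [exact: cy|exact: cPhi]. Qed.

Lemma rate_dist (y1 y2 : R -> R) : continuous y1 -> continuous y2 ->
  {ae mu, forall t, forall e, 0 <= e ->
    (forall s, nu t <= s < t -> `|Phi (y1 s) - Phi (y2 s)| <= e) ->
    `|rate y1 t - rate y2 t| <= e * (C * g t)}.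
Proof.
move=> c1 c2; apply: filterS Itg_dist => t dt e e0 d12.
rewrite /rate -mulrBr normrM ger0_norm// mulrC mulrA ler_wpM2r//.
by apply: dt => //; exact: comp_Phi.
Qed.

Lemma rate_bound (y : R -> R) : continuous y ->
  {ae mu, forall t, forall M, 0 <= M ->
    (forall s, nu t <= s < t -> `|Phi (y s)| <= M) ->
    `|rate y t| <= M * (C * g t)}.
Proof.
move=> cy; apply: filterS2 Itg_dist Itg_cst => t dt ct M M0' yM.
rewrite /rate normrM ger0_norm// mulrC mulrA ler_wpM2r//.
rewrite -[Itg _ t]subr0.
have -> : 0 = Itg (fun=> 0) t by rewrite ct mul0r.
apply: dt => //; first exact: comp_Phi.
  by move=> s; exact: cvg_cst.
by move=> s st; rewrite subr0 yM.
Qed.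

Lemma rate_loc_integrable (y : R -> R) : continuous y -> loc_integrable (rate y).
Proof.
move=> cy; apply: (loc_integrable_bound _ lg).
  by apply: ae_measurableM; [exact: lg.1|exact/mItg/comp_Phi].
move=> a b; have [N NP] := nuB a b.
have [M MP] := continuous_bounded_segment N b (comp_Phi cy).
exists (`|M| * C); apply: filterS2 NP (rate_bound cy) => t Nt rt tab.
rewrite -mulrA; apply: rt => // s /andP[ns st].
rewrite (le_trans (MP _ _)) ?ler_norm// (le_trans (Nt tab) ns).
by rewrite (le_trans (ltW st))//; case/andP: tab.
Qed.

Lemma rate_anti (y1 y2 : R -> R) : continuous y1 -> continuous y2 ->
  (forall t, y1 t <= y2 t) -> {ae mu, forall t, rate y2 t <= rate y1 t}.
Proof.
move=> c1 c2 y12; apply: filterS Itg_le => t lt.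
rewrite /rate ler_wpM2l//; apply: lt; try exact: comp_Phi.
by move=> s _ /=; exact: Phi_le.
Qed.

Lemma mass_le_rate (y : R -> R) : continuous y ->
  {ae mu, forall t, forall d, (forall s, nu t <= s < t -> d <= Phi (y s)) ->
    d * (g t * m t) <= rate y t}.
Proof.
move=> cy; apply: filterS2 Itg_le Itg_cst => t lt ct d yd.
rewrite /rate mulrCA ler_wpM2l// -ct.
by apply: lt => //; [move=> s; exact: cvg_cst|exact: comp_Phi].
Qed.

Lemma rate_le_mass (y : R -> R) : continuous y ->
  {ae mu, forall t, forall d, (forall s, nu t <= s < t -> Phi (y s) <= d) ->
    rate y t <= d * (g t * m t)}.
Proof.
move=> cy; apply: filterS2 Itg_le Itg_cst => t lt ct d yd.
rewrite /rate [leRHS]mulrCA ler_wpM2l// -ct.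
by apply: lt => //; [exact: comp_Phi|move=> s; exact: cvg_cst].
Qed.

Lemma rate_ge0 (y : R -> R) T : continuous y ->
  (forall s, s < T -> 0 <= Phi (y s)) ->
  {ae mu, forall t, t <= T -> 0 <= rate y t}.
Proof.
move=> cy y0; apply: filterS (mass_le_rate cy) => t rt tT.
rewrite -(mul0r (g t * m t)); apply: rt => s /andP[_ st].
by apply: y0; exact: lt_le_trans tT.
Qed.

Lemma rate_le1 (y : R -> R) : continuous y ->
  {ae mu, forall t, rate y t <= C * g t}.
Proof.
move=> cy; apply: filterS2 (rate_le_mass cy) mC => t rt mt.
rewrite -[leRHS]mul1r (le_trans (rt 1 _))//.
by rewrite !mul1r mulrC ler_wpM2r.
Qed.

(** ** Solutions on the past of [t0] *)

Section backward.
Variables (t0 L : R).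
Hypothesis PhiL : 0 <= Phi L.

(** Bounding the increments makes [D] closed under suprema: without it a
    supremum of continuous functions need not be continuous, and the operator
    would not be defined on it. *)
Let D : set (R -> R) := [set y | (forall t, y t <= L) /\
  forall s t, s <= t -> 0 <= y t - y s <= clock t - clock s].

Let T (y : R -> R) t :=
  L + (primitive (rate y) (Num.min t t0) - primitive (rate y) t0).

Let D_continuous y : D y -> continuous y.
Proof.
move=> [_ Dy]; apply: (modulus_continuous clock_continuous) => T'.
by exists 1 => s t st _; have /andP[y0 yA] := Dy s t st; rewrite mul1r ger0_norm.
Qed.

Let D_incr y a b : D y -> a <= b ->
  0 <= primitive (rate y) b - primitive (rate y) a <= clock b - clock a.
Proof.
move=> Dy ab; have cy := D_continuous Dy; apply/andP; split.
  rewrite subr_ge0; apply: primitive_nondecreasing => //.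
    exact: rate_loc_integrable.
  have yL s : s < b -> 0 <= Phi (y s).
    by move=> _; apply: le_trans PhiL _; apply: Phi_le; exact: Dy.1.
  by apply: filterS (rate_ge0 cy yL) => t rt /andP[_ /rt].
apply: le_primitive => //; first exact: rate_loc_integrable.
by apply: filterS (rate_le1 cy).
Qed.

Let T_D y : D y -> D (T y).
Proof.
move=> Dy; split=> [t|s t st].
  have mt : Num.min t t0 <= t0 by rewrite ge_min lexx orbT.
  have /andP[i0 _] := D_incr Dy mt; rewrite /T; lra.
have mst : Num.min s t0 <= Num.min t t0.
  by rewrite le_min !ge_min st lexx orbT.
have /andP[i0 iA] := D_incr Dy mst.
rewrite /T shifted_increment i0; apply: le_trans iA _.
by have /andP[] := clock_min t0 st.
Qed.

(** Two reversals of order: [Phi] is nonincreasing and time runs backwards. *)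
Let T_mono y1 y2 : D y1 -> D y2 -> (forall t, y1 t <= y2 t) ->
  forall t, T y1 t <= T y2 t.
Proof.
move=> D1 D2 y12 t; rewrite /T lerD2l -[leRHS]opprB -[leLHS]opprB lerN2.
apply: le_primitive; try exact/rate_loc_integrable/D_continuous.
  by rewrite ge_min lexx orbT.
by apply: filterS (rate_anti (D_continuous D1) (D_continuous D2) y12).
Qed.

(** Knaster-Tarski: the supremum of the [y] in [D] such that [y <= T y].  The set
    is not empty because it contains [y0], the lowest past with value [L] at [t0]
    that the bound on the increments allows. *)
Lemma backward_solution : exists x : R -> R,
  [/\ forall t, x t <= L,
      x t0 = L,
      forall s t, s <= t -> 0 <= x t - x s <= clock t - clock s &
      forall t, t <= t0 ->
        x t = L + (primitive (rate x) t - primitive (rate x) t0)].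
Proof.
pose S : set (R -> R) := [set y | D y /\ forall t, y t <= T y t].
pose y0 t := L + (clock (Num.min t t0) - clock t0).
have mint t : Num.min t t0 <= t0 by rewrite ge_min lexx orbT.
have Dy0 : D y0.
  split=> [t|s t st]; last by rewrite /y0 shifted_increment clock_min.
  have := clock_le (mint t); rewrite /y0; lra.
have Sy0 : S y0.
  split=> // t; have /andP[_ h] := D_incr Dy0 (mint t).
  by rewrite /T /y0; lra.
pose x t := sup [set y t | y in S].
have hsup t : has_sup [set y t | y in S].
  split; first by exists (y0 t); exists y0.
  by exists L => _ [y [[yL _] _] <-].
have ub y t : S y -> y t <= x t.
  by move=> Sy; apply: sup_upper_bound => //; exists y.
have le_x t b : (forall y, S y -> y t <= b) -> x t <= b.
  by move=> yb; apply: ge_sup => [|_ [y Sy <-]]; [exact: (hsup t).1|exact: yb].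
have Dx : D x.
  split=> [t|s t st]; first by apply: le_x => y [[]].
  apply/andP; split.
    rewrite subr_ge0; apply: le_x => y Sy; apply: le_trans (ub y t Sy).
    by have /andP[] := Sy.1.2 s t st; rewrite subr_ge0.
  rewrite lerBlDr; apply: le_x => y Sy; have := ub y s Sy.
  have /andP[] := Sy.1.2 s t st; lra.
have xT t : x t <= T x t.
  apply: le_x => y Sy; apply: le_trans (Sy.2 t) _.
  by apply: T_mono => //; [exact: Sy.1|move=> s; exact: ub].
have Tx t : T x t <= x t.
  apply: ub; split; first exact: T_D.
  by apply: T_mono => //; exact: T_D.
have xE t : x t = T x t by apply/eqP; rewrite eq_le xT Tx.
exists x; split => //.
- exact: Dx.1.
- by rewrite xE /T minxx subrr addr0.
- exact: Dx.2.
- by move=> t tt0; rewrite {1}xE /T min_l.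
Qed.

End backward.

(** Causality: the rate at time [t] depends only on the values before [t]. *)
Lemma rate_incr_eq (y1 y2 : R -> R) a b T : continuous y1 -> continuous y2 ->
  (forall s, s < T -> y1 s = y2 s) -> a <= b -> b <= T ->
  primitive (rate y1) b - primitive (rate y1) a =
  primitive (rate y2) b - primitive (rate y2) a.
Proof.
move=> c1 c2 y12 ab bT; apply/eqP; rewrite -subr_eq0 -normr_le0.
rewrite -(mul0r (clock b - clock a)); apply: primitive_dist => //;
  try exact: rate_loc_integrable.
apply: filterS (rate_dist c1 c2) => t rt /andP[_ tb]; apply: rt => // s /andP[_ st].
by rewrite y12 ?subrr ?normr0// (lt_le_trans st)// (le_trans tb).
Qed.

(** ** Continuation to the future of [t0] *)

Section forward.
Variables (t0 L : R) (P : R -> R).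
Hypothesis Pt0 : P t0 = L.
Hypothesis P_incr : forall s t, s <= t -> 0 <= P t - P s <= clock t - clock s.

(** [U] is the a priori upper bound that follows from [Phi <= 1].  Along a
    function below [U], [Phi] lies in [Phi (U t), 1] up to time [t], and [M t]
    bounds its absolute value; the summand 1 also covers the given past, whose
    modulus is [clock] itself. *)
Let U t := L + (clock (Num.max t t0) - clock t0).
Let M t := 1 + `|Phi (U t)|.

Let M0 t : 0 <= M t. Proof. by rewrite addr_ge0. Qed.

Let U_le s t : s <= t -> U s <= U t.
Proof.
by move=> st; rewrite lerD2l lerD2r clock_le// ge_max !le_max st lexx orbT.
Qed.

Let U_max t : U (Num.max t t0) = U t.
Proof. by rewrite /U -maxA maxxx. Qed.

Let PhiM (y : R -> R) t : (forall s, y s <= U s) ->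
  forall s, s < Num.max t t0 -> `|Phi (y s)| <= M t.
Proof.
move=> yU s st; have lo : Phi (U t) <= Phi (y s).
  apply: Phi_le; rewrite -U_max; apply: le_trans (yU s) _.
  exact/U_le/ltW.
have := Phi1 (y s); have := ler_norm (- Phi (U t)).
have := normr_ge0 (Phi (U t)); rewrite normrN /M ler_norml; move: lo.
by move=> h1 h2 h3 h4; apply/andP; split; lra.
Qed.

Let delta (n : nat) : R := n.+1%:R^-1.
Let shift (n : nat) (y : R -> R) s := y (s - delta n).

(** One step of Tonelli's scheme; for [t <= t0] the two primitives cancel and
    the value is [P t]. *)
Let S (n : nat) (y : R -> R) t := P (Num.min t t0) +
  (primitive (rate (shift n y)) (Num.max t t0) - primitive (rate (shift n y)) t0).
Let E : set (R -> R) := [set y | continuous y /\ forall t, y t <= U t].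
Let modulus (y : R -> R) := forall T s t, s <= t -> t <= T ->
  `|y t - y s| <= M T * (clock t - clock s).

Let delta0 n : 0 < delta n. Proof. by rewrite invr_gt0. Qed.

Let shift_continuous n y : continuous y -> continuous (shift n y).
Proof.
move=> cy s; apply: (@continuous_comp _ _ _ (fun s => s - delta n) y).
  by apply: cvgB; [exact: cvg_id|exact: cvg_cst].
exact: cy.
Qed.

Let shift_U n y : (forall t, y t <= U t) -> forall t, shift n y t <= U t.
Proof.
by move=> yU t; apply: le_trans (yU _) (U_le _); rewrite gerBl ltW.
Qed.

Let modulus_cont y : modulus y -> continuous y.
Proof.
move=> my; apply: (modulus_continuous clock_continuous) => T.
by exists (M T) => s t; exact: my.
Qed.

Let minmax_clock t : clock (Num.min t t0) + clock (Num.max t t0) =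
  clock t + clock t0.
Proof. by have [tt0|tt0] := leP t t0; rewrite // addrC. Qed.

Let S_modulus n y : E y -> modulus (S n y).
Proof.
move=> [cy yU] T s t st tT.
have cS := shift_continuous (n := n) cy.
have min_st : Num.min s t0 <= Num.min t t0.
  by rewrite le_min !ge_min st lexx orbT.
have max_st : Num.max s t0 <= Num.max t t0.
  by rewrite ge_max !le_max st lexx orbT.
have /andP[P0 PA] := P_incr min_st.
have h : `|primitive (rate (shift n y)) (Num.max t t0) -
           primitive (rate (shift n y)) (Num.max s t0)| <=
         M T * (clock (Num.max t t0) - clock (Num.max s t0)).
  have := @primitive_dist _ (rate (shift n y)) (fun=> 0) (fun t => C * g t) (M T)
    _ _ (rate_loc_integrable cS) (loc_integrable0 R) lCg max_st.
  rewrite !primitive0 subrr subr0; apply.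
  apply: filterS (rate_bound cS) => r hr /andP[_ rt].
  rewrite subr0; apply: hr => // q /andP[_ qr]; apply: PhiM; first exact: shift_U.
  apply: lt_le_trans qr (le_trans rt _).
  by rewrite ge_max !le_max tT lexx orbT.
rewrite /S; set p := primitive (rate (shift n y)).
rewrite (increment_split (minmax_clock t) (minmax_clock s)) paired_increment.
apply: le_trans (ler_normD _ _) _; rewrite mulrDr lerD//.
rewrite ger0_norm//; apply: le_trans PA _.
rewrite ler_peMl ?subr_ge0 ?clock_le// /M lerDl//.
Qed.

Let S_E n y : E y -> E (S n y).
Proof.
move=> Ey; split; first exact/modulus_cont/S_modulus.
move=> t; have [cy yU] := Ey; have cS := shift_continuous (n := n) cy.
have tm : t0 <= Num.max t t0 by rewrite le_max lexx orbT.
have := le_primitive (rate_loc_integrable cS) lCg tm _.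
have lr : {ae mu, forall s, t0 <= s <= Num.max t t0 ->
    rate (shift n y) s <= C * g s}.
  by apply: filterS (rate_le1 cS).
move=> /(_ lr).
have mt : Num.min t t0 <= t0 by rewrite ge_min lexx orbT.
have /andP[] := P_incr mt; rewrite Pt0 /S /U /clock; lra.
Qed.

Let y0 t := P (Num.min t t0).

Let y0_E : E y0.
Proof.
have min_st s t : s <= t -> Num.min s t0 <= Num.min t t0.
  by move=> st; rewrite le_min !ge_min st lexx orbT.
split.
  apply: (modulus_continuous clock_continuous) => T; exists 1 => s t st _.
  have /andP[P0 PA] := P_incr (min_st s t st).
  rewrite ger0_norm// mul1r; apply: le_trans PA _.
  by have /andP[] := clock_min t0 st.
move=> t; have mt : Num.min t t0 <= t0 by rewrite ge_min lexx orbT.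
have /andP[P0 _] := P_incr mt.
have tm : t0 <= Num.max t t0 by rewrite le_max lexx orbT.
have := clock_le tm; move: P0; rewrite Pt0 /y0 /U; lra.
Qed.

(** By [it_stable], [k] steps determine the approximation up to time
    [t0 + k delta]. *)
Let it n k := iter k (S n) y0.

Let it_E n k : E (it n k).
Proof. by elim: k => [|k IHk]; [exact: y0_E|exact: S_E]. Qed.

Let it_stable n k t : t <= t0 + k%:R * delta n -> it n k.+1 t = it n k t.
Proof.
elim: k t => [|k IHk] t tk.
  rewrite mul0r addr0 in tk.
  by rewrite /it/= /S max_r// subrr addr0.
rewrite -[LHS]/(S n (it n k.+1) t) -[RHS]/(S n (it n k) t) /S; congr (_ + _).
have ck j := shift_continuous (n := n) (it_E n j).1.
apply: (@rate_incr_eq _ _ _ _ (t0 + k.+1%:R * delta n)) => //.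
- move=> s sk; apply: IHk; rewrite lerBlDr (le_trans (ltW sk))//.
  by rewrite -addrA lerD2l -natr1 mulrDl mul1r.
- by rewrite le_max lexx orbT.
- by rewrite ge_max tk lerDl mulr_ge0// ltW.
Qed.

(** [(n+1)^2] steps of length [1/(n+1)] reach the time [t0 + n + 1], so that any
    bounded interval is covered for large [n].  The additional step makes [x_ n] a
    value of [S n], which provides its modulus of continuity. *)
Let x_ n := it n (n.+1 * n.+1).+1.

Let x_modulus n : modulus (x_ n).
Proof. exact: (@S_modulus n _ (it_E n (n.+1 * n.+1))). Qed.

Let x_fix n t : t <= t0 + n.+1%:R -> x_ n t = S n (x_ n) t.
Proof.
move=> tn; rewrite -[RHS]/(it n (n.+1 * n.+1).+2 t) it_stable//.
apply: le_trans tn _; rewrite lerD2l /delta ler_pdivlMr// -natrM ler_nat.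
exact: leqnSn.
Qed.

Let x_past n t : t <= t0 -> x_ n t = P t.
Proof. by move=> tt0; rewrite /x_/= /S min_l// max_r// subrr addr0. Qed.

(** Along the ultrafilter limit [x], closeness of [x_ n] and [x] at the points of
    a finite net, together with the common modulus of continuity, bounds
    [x_ n (s - delta n) - x s] uniformly in [s]; the rates are then uniformly
    close, relative to [C g]. *)
Lemma forward_solution : exists x : R -> R,
  [/\ forall t, t <= t0 -> x t = P t,
      forall T, exists N, forall s t, s <= t -> t <= T ->
        `|x t - x s| <= N * (clock t - clock s) &
      forall t, t0 <= t ->
        x t = L + (primitive (rate x) t - primitive (rate x) t0)].
Proof.
have x_bound n t : `|x_ n t| <= `|L| + M (Num.max t t0) * `|clock t - clock t0|.
  have -> : x_ n t = L + (x_ n t - x_ n t0) by rewrite (x_past _ (lexx t0)) Pt0; lra.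
  apply: le_trans (ler_normD _ _) _; rewrite lerD2l.
  have [tt0|/ltW t0t] := leP t t0.
    rewrite distrC [`|clock _ - _|]distrC (le_trans (x_modulus n tt0 (lexx _)))//.
    by rewrite ler_wpM2l// ler_norm.
  by rewrite (le_trans (x_modulus n t0t (lexx _)))// ler_wpM2l// ler_norm.
have [x xP] := bounded_seq_limit_point x_bound.
have mx : modulus x.
  move=> T s t st tT; apply/ler_addgt0Pr => e e0.
  have e2 : 0 < e / 2 by rewrite divr_gt0.
  have [n _ nP] := xP [:: s; t] _ 0%N e2.
  have := nP s; have := nP t; rewrite !inE !eqxx orbT => /(_ isT) xt /(_ isT) xs.
  have := x_modulus n st tT; rewrite distrC in xt.
  have := ler_distD (x_ n t) (x t) (x s).
  have := ler_distD (x_ n s) (x_ n t) (x s); lra.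
exists x; split => [t tt0|T|T t0T].
- apply/eqP; rewrite -subr_eq0 -normr_le0; apply/ler_addgt0Pr => e e0.
  have [n _ nP] := xP [:: t] _ 0%N e0.
  have := nP t; rewrite inE eqxx x_past// => /(_ isT)/ltW.
  by rewrite distrC add0r.
- by exists (M T) => s t; exact: mx.
have cx := modulus_cont mx.
have [N' N'P] := nuB t0 T; pose N := Num.min N' t0.
have NT : N <= T by rewrite (le_trans _ t0T)// ge_min lexx orbT.
have Nt0 : N <= t0 by rewrite ge_min lexx orbT.
apply/eqP; rewrite -subr_eq0 -normr_le0.
suff close e : 0 < e -> `|x T - (L + (primitive (rate x) T - primitive (rate x) t0))|
    <= e * (1 + (clock T - clock t0)).
  have c0 : 0 < 1 + (clock T - clock t0) by rewrite ltr_pwDl// subr_ge0 clock_le.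
  apply/ler_addgt0Pr => e e0; rewrite add0r.
  have := close (e / (1 + (clock T - clock t0))) (divr_gt0 e0 c0).
  by rewrite divfK// gt_eqF.
move=> e0.
(* [N - 1] leaves room for the time shift, which is at most 1; [B] bounds all
   approximations and their limit on [N - 1, T]. *)
pose B := `|L| + M T * (clock T - clock (N - 1)).
have xB s : N - 1 <= s <= T -> forall y, modulus y -> y t0 = L -> - B <= y s <= B.
  move=> /andP[Ns sT] y my yt0; rewrite -ler_norml.
  have -> : y s = L + (y s - y t0) by rewrite yt0; lra.
  apply: le_trans (ler_normD _ _) _; rewrite lerD2l.
  have [st0|/ltW t0s] := leP s t0.
    rewrite distrC (le_trans (my _ _ _ st0 t0T))// ler_wpM2l//.
    by rewrite lerB// clock_le.
  rewrite (le_trans (my _ _ _ t0s sT))// ler_wpM2l// lerB// clock_le//.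
  by rewrite (le_trans _ Nt0)// gerBl.
have [d1 d1_gt0 d1P] := continuous_unif_segment (- B) B cPhi e0.
have d4 : 0 < d1 / 4 by rewrite divr_gt0.
have M1 : 0 < M T + 1 by rewrite ltr_wpDl.
have [d2 d2_gt0 d2P] := continuous_unif_segment (N - 1) T clock_continuous
  (divr_gt0 d4 M1).
have modd y s t : modulus y -> s <= t -> t <= T -> N - 1 <= s -> t - s < d2 ->
    `|y t - y s| <= d1 / 4.
  move=> my st tT Ns ts; apply: le_trans (my _ _ _ st tT) _.
  have : `|clock s - clock t| <= d1 / 4 / (M T + 1).
    apply: d2P; first by rewrite Ns (le_trans st tT).
    by rewrite distrC ger0_norm ?subr_ge0.
  rewrite distrC ger0_norm ?subr_ge0 ?clock_le// ler_pdivlMr// => h.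
  apply: le_trans h; rewrite mulrC ler_wpM2l ?subr_ge0 ?clock_le//.
  by rewrite lerDl.
have [net netP] := finite_net N T d2_gt0.
(* the first summand makes the shift smaller than [d2], the second makes [T] lie
   in the range where [x_ n] is a fixed point *)
pose k0 := (Num.truncn (d2^-1) + Num.truncn (T - t0))%N.
have ee : 0 < Num.min e (d1 / 4) by rewrite lt_min e0.
have [n k0n nP] := xP (T :: net) _ k0 ee.
have dn : delta n < d2.
  rewrite /delta invf_plt ?posrE//; apply: lt_le_trans (truncnS_gt _) _.
  by rewrite ler_nat ltnS (leq_trans _ k0n)// leq_addr.
have Tn : T <= t0 + n.+1%:R.
  rewrite -lerBlDl; apply: (le_trans (ltW (truncnS_gt _))).
  by rewrite ler_nat ltnS (leq_trans _ k0n)// leq_addl.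
have dn1 : delta n <= 1 by rewrite /delta invf_le1// ler1n.
have xt0 : x t0 = L.
  apply/eqP; rewrite -subr_eq0 -normr_le0; apply/ler_addgt0Pr => r r0.
  have [j _ jP] := xP [:: t0] _ 0%N r0.
  have := jP t0; rewrite inE eqxx x_past// Pt0 => /(_ isT)/ltW.
  by rewrite distrC add0r.
have closePhi s : N <= s < T -> `|Phi (shift n (x_ n) s) - Phi (x s)| <= e.
  move=> /andP[Ns sT].
  have N1s : N - 1 <= s by rewrite (le_trans _ Ns)// gerBl.
  have NTs : N <= s <= T by rewrite Ns ltW.
  rewrite distrC; apply: d1P.
    by apply: xB => //; rewrite N1s ltW.
  have [q qnet [/andP[Nq qs] sq]] := netP s NTs.
  have N1q : N - 1 <= q by rewrite (le_trans _ Nq)// gerBl.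
  have := nP q; rewrite inE qnet orbT => /(_ isT); rewrite lt_min => /andP[_].
  move=> xq; apply: (@dist_chain _ _ (x q) (x_ n q) (x_ n s)).
  - exact: modd mx qs (ltW sT) N1q sq.
  - by rewrite distrC.
  - by rewrite distrC; exact: modd (x_modulus n) qs (ltW sT) N1q sq.
  - apply: modd => //; [by rewrite gerBl ltW|exact: ltW| |].
      by rewrite lerB.
    by rewrite opprB addrC subrK.
have cS := shift_continuous (n := n) (modulus_cont (x_modulus n)).
have incr : `|(primitive (rate (shift n (x_ n))) T - primitive (rate (shift n (x_ n))) t0)
    - (primitive (rate x) T - primitive (rate x) t0)| <= e * (clock T - clock t0).
  apply: primitive_dist => //; try exact: rate_loc_integrable.
  apply: filterS2 N'P (rate_dist cS cx) => t Nt rt /[dup] tT /andP[_ tT'].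
  apply: rt => [|s /andP[ns st]]; first exact: ltW.
  apply: closePhi; rewrite (lt_le_trans st tT') andbT (le_trans _ ns)//.
  by rewrite ge_min Nt.
have := nP T; rewrite inE eqxx => /(_ isT); rewrite lt_min => /andP[+ _].
rewrite x_fix// /S min_r// max_l// Pt0 mulrDr mulr1 distrC => xT.
set q := primitive (rate (shift n (x_ n))) in incr xT.
apply: le_trans (ler_distD (L + (q T - q t0)) _ _) _.
by rewrite lerD ?(ltW xT)// addl_increment.
Qed.

End forward.

Lemma delay_solution (t0 L : R) : 0 <= Phi L -> exists x : R -> R,
  [/\ forall T, exists M, forall s t, s <= t -> t <= T ->
        `|x t - x s| <= M * (clock t - clock s),
      forall t, x t = L + (primitive (rate x) t - primitive (rate x) t0),
      forall t, t <= t0 -> x t <= L &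
      forall s t, s <= t -> t <= t0 -> x s <= x t].
Proof.
move=> PhiL; have [P [PL Pt0 P_incr Peq]] := backward_solution t0 PhiL.
have [x [xP xmod xeq]] := forward_solution Pt0 P_incr.
have cx := modulus_continuous clock_continuous xmod.
have cP : continuous P.
  apply: (modulus_continuous clock_continuous) => T; exists 1 => s t st _.
  by have /andP[P0 PA] := P_incr s t st; rewrite mul1r ger0_norm.
exists x; split => //.
- move=> t; have [tt0|/ltW t0t] := leP t t0; last exact: xeq.
  rewrite xP// Peq//; congr (_ + _); rewrite -[LHS]opprB -[RHS]opprB; congr (- _).
  apply: (@rate_incr_eq _ _ _ _ t0) => // s st0.
  by rewrite xP// ltW.
- by move=> t tt0; rewrite xP.
- move=> s t st tt0; rewrite (xP s (le_trans st tt0)) (xP t tt0).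
  by have /andP[] := P_incr s t st; rewrite subr_ge0.
Qed.

(** ** Behaviour of solutions at -oo and +oo *)

Section asymptotics.
Variables (t0 L : R) (x : R -> R).
Hypothesis xmod : forall T, exists M, forall s t, s <= t -> t <= T ->
  `|x t - x s| <= M * (clock t - clock s).
Hypothesis xeq : forall t,
  x t = L + (primitive (rate x) t - primitive (rate x) t0).

Let cx : continuous x. Proof. exact: (modulus_continuous clock_continuous xmod). Qed.

Let x_incr a b : x b - x a = primitive (rate x) b - primitive (rate x) a.
Proof. by rewrite xeq [x a]xeq; lra. Qed.

(** In the past [Phi x >= Phi L > 0] and [m >= e], so [x] decreases at least as
    fast as a positive multiple of [clock]. *)
Lemma solution_cvgNy (T0 e : R) : 0 < Phi L -> (forall t, t <= t0 -> x t <= L) ->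
  0 < e -> {ae mu, forall t, t <= T0 -> e <= m t} ->
  clock t @[t --> -oo] --> -oo -> x t @[t --> -oo] --> -oo.
Proof.
move=> PhiL xL e0 em ck; pose T := Num.min t0 T0.
have Tt0 : T <= t0 by rewrite ge_min lexx.
have TT0 : T <= T0 by rewrite ge_min lexx orbT.
pose k := Phi L * e / C.
have k0 : 0 < k by rewrite divr_gt0// mulr_gt0.
have xk t : t <= T -> x t <= x T - k * (clock T - clock t).
  move=> tT; rewrite lerBrDl -lerBrDr x_incr.
  have lk : loc_integrable (fun s => k * (C * g s)) by exact: loc_integrableZ.
  rewrite /clock mulrBr -!(primitiveZ k _ lCg); apply: le_primitive => //.
    exact: rate_loc_integrable.
  apply: filterS2 em (mass_le_rate cx) => s es rs /andP[_ sT].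
  apply: (@le_trans _ _ (Phi L * (g s * m s))); last first.
    apply: rs => r /andP[_ rs]; apply: Phi_le; apply: xL.
    by rewrite (le_trans (ltW rs))// (le_trans sT).
  rewrite /k [_ * (C * _)]mulrA divfK ?gt_eqF// -mulrA ler_wpM2l ?(ltW PhiL)//.
  by rewrite mulrC ler_wpM2l// es// (le_trans sT).
apply/cvgrNyPle => A.
move: ck => /cvgrNyPle/(_ ((A - x T) / k + clock T)) ck.
near=> t; have tT : t <= T by near: t; exact: (nbhs_ninfty_le (num_real T)).
have ct : clock t <= (A - x T) / k + clock T by near: t.
apply: le_trans (xk t tT) _.
have : k * (clock t - clock T) <= A - x T.
  by rewrite mulrC -ler_pdivlMr// lerBlDr.
rewrite !mulrBr; lra.
Unshelve. all: by end_near. Qed.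

Hypothesis nu_pinfty : forall N, exists T, {ae mu, forall t, T <= t -> N <= nu t}.
Hypothesis lgm : loc_integrable (fun t => g t * m t).
Let W := primitive (fun t => g t * m t).
(** With [d = 0] this says that [x] is eventually monotone, and with [d > 0] that
    its increments control those of the primitive of [g * m]. *)
Lemma mass_le_incr (N d : R) : (forall s, N <= s -> d <= Phi (x s)) ->
  exists T, forall a b, T <= a -> a <= b -> d * (W b - W a) <= x b - x a.
Proof.
move=> xd; have [T TP] := nu_pinfty N; exists T => a b Ta ab.
rewrite x_incr /W mulrBr -!(primitiveZ d _ lgm); apply: le_primitive => //.
- exact: loc_integrableZ.
- exact: rate_loc_integrable.
apply: filterS2 TP (mass_le_rate cx) => t Tt rt /andP[at_ tb].
by apply: rt => s /andP[ns _]; apply: xd; apply: le_trans ns; apply: Tt; exact: le_trans at_.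
Qed.

Lemma incr_le_mass (N d : R) : (forall s, N <= s -> Phi (x s) <= d) ->
  exists T, forall a b, T <= a -> a <= b -> x b - x a <= d * (W b - W a).
Proof.
move=> xd; have [T TP] := nu_pinfty N; exists T => a b Ta ab.
rewrite x_incr /W mulrBr -!(primitiveZ d _ lgm); apply: le_primitive => //.
- exact: rate_loc_integrable.
- exact: loc_integrableZ.
apply: filterS2 TP (rate_le_mass cx) => t Tt rt /andP[at_ tb].
by apply: rt => s /andP[ns _]; apply: xd; apply: le_trans ns; apply: Tt; exact: le_trans at_.
Qed.

End asymptotics.

End delay_equation.

(** * The logistic response *)

Section signed_power.
Context (R : realType).
Implicit Types l v w : R.

Definition signed_powR l v : R := `|v| `^ l * Num.sg v.

Lemma signed_powR_gt0 l v : 0 < v -> signed_powR l v = v `^ l.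
Proof. by move=> v0; rewrite /signed_powR gtr0_sg// mulr1 gtr0_norm. Qed.

Lemma signed_powR0 l : signed_powR l 0 = 0.
Proof. by rewrite /signed_powR sgr0 mulr0. Qed.

Lemma signed_powRN l v : signed_powR l (- v) = - signed_powR l v.
Proof. by rewrite /signed_powR normrN sgrN mulrN. Qed.

Lemma signed_powR_nondecreasing l : 0 < l ->
  {homo signed_powR l : v w / v <= w}.
Proof.
move=> l0; have pos v w : 0 <= v -> v <= w -> signed_powR l v <= signed_powR l w.
  rewrite le_eqVlt => /predU1P[<- w0|v0 vw]; rewrite ?signed_powR0.
    by rewrite /signed_powR mulr_ge0 ?powR_ge0// sgr_ge0.
  have w0 := lt_le_trans v0 vw; rewrite !signed_powR_gt0//.
  by apply: ge0_ler_powR => //; rewrite ?nnegrE ltW.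
move=> v w vw; have [v0|v0] := leP 0 v; first exact: pos.
have [w0|w0] := leP 0 w.
  apply: (@le_trans _ _ 0); rewrite /signed_powR.
    by rewrite mulr_ge0_le0 ?powR_ge0// sgr_le0 ltW.
  by rewrite mulr_ge0 ?powR_ge0// sgr_ge0.
by rewrite -[v]opprK -[w]opprK (signed_powRN l (- v)) (signed_powRN l (- w)) lerN2 pos// ?lerN2// oppr_ge0 ltW.
Qed.

Lemma signed_powR_surjective l w : 0 < l -> exists v, signed_powR l v = w.
Proof.
move=> l0; have pos x : 0 < x -> exists v, signed_powR l v = x.
  move=> x0; exists (x `^ l^-1); rewrite signed_powR_gt0 ?powR_gt0//.
  by rewrite -powRrM mulVf ?gt_eqF// powRr1 ?ltW.
have [w0|w0|->] := ltgtP w 0; last by exists 0; rewrite signed_powR0.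
- have [|v vw] := pos (- w); first by rewrite oppr_gt0.
  by exists (- v); rewrite signed_powRN vw opprK.
- exact: pos.
Qed.

(** A nondecreasing surjection is continuous. *)
Lemma signed_powR_continuous l : 0 < l -> continuous (signed_powR l).
Proof.
move=> l0 v; apply/cvgrPdist_lt => e e0.
have [c cE] := signed_powR_surjective (signed_powR l v - e / 2) l0.
have [d dE] := signed_powR_surjective (signed_powR l v + e / 2) l0.
have nd := signed_powR_nondecreasing l0.
have e2 : 0 < e / 2 by rewrite divr_gt0.
have cv : c < v.
  by rewrite ltNge; apply/negP => /nd; rewrite cE lerBrDr gerDl leNgt e2.
have vd : v < d.
  by rewrite ltNge; apply/negP => /nd; rewrite dE gerDl leNgt e2.
near=> w.
have cw : c <= w by apply: ltW; near: w; exact: lt_nbhsr.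
have wd : w <= d by apply: ltW; near: w; exact: lt_nbhsl.
have := nd _ _ cw; have := nd _ _ wd; rewrite cE dE ltr_norml.
by move=> h1 h2; apply/andP; split; lra.
Unshelve. all: by end_near. Qed.

End signed_power.

Section logistic_response.
Context (R : realType) (kappa lambda : R).
Hypothesis kappa0 : 0 < kappa.
Hypothesis lambda0 : 0 < lambda.

(** The nonlinearity of the logistic equation as a function of [y = ln u]. *)
Definition response (y : R) : R := signed_powR lambda (1 - expR y / kappa).

Lemma response_continuous : continuous response.
Proof.
move=> y; apply: (@continuous_comp _ _ _ (fun y => 1 - expR y / kappa)).
  apply: cvgB; first exact: cvg_cst.
  by apply: cvgM; [exact: continuous_expR|exact: cvg_cst].
exact: signed_powR_continuous.
Qed.

Lemma response_le : {homo response : x y / x <= y >-> y <= x}.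
Proof.
move=> x y xy; apply: signed_powR_nondecreasing => //.
by rewrite lerB// ler_pM2r ?invr_gt0// ler_expR.
Qed.

Lemma response_le1 y : response y <= 1.
Proof.
apply: (@le_trans _ _ (signed_powR lambda 1)).
  apply: signed_powR_nondecreasing => //.
  by rewrite gerBl divr_ge0 ?expR_ge0// ltW.
by rewrite signed_powR_gt0// powR1.
Qed.

Lemma response_ln : response (ln kappa) = 0.
Proof. by rewrite /response lnK ?posrE// divff ?gt_eqF// subrr signed_powR0. Qed.

Lemma response_gt0 y : y < ln kappa -> 0 < response y.
Proof.
move=> yk; have h : 0 < 1 - expR y / kappa.
  by rewrite subr_gt0 ltr_pdivrMr// mul1r -[ltRHS]lnK ?posrE// ltr_expR.
by rewrite /response signed_powR_gt0// powR_gt0.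
Qed.

Lemma response_lt0 y : ln kappa < y -> response y < 0.
Proof.
move=> ky; have h : 0 < - (1 - expR y / kappa).
  by rewrite opprB subr_gt0 ltr_pdivlMr// mul1r -[ltLHS]lnK ?posrE// ltr_expR.
by rewrite /response -oppr_gt0 -signed_powRN signed_powR_gt0// powR_gt0.
Qed.

End logistic_response.

(** * The logistic equation *)

Section ess_inf_limits.
Context (R : realType).
Notation mu := (@lebesgue_measure R).

Lemma ess_inf_on_ae (i : interval R) (f : R -> R) (e : R) :
  (e%:E <= ess_inf_on i f)%E -> {ae mu, forall t, t \in i -> e <= f t}.
Proof.
move=> /ess_infP[N [mN N0 subN]].
exists (N `&` [set` i]); split => //; first exact: measurableI.
move=> t /= /not_implyP[ti ft]; split => //.
by apply: subN => /=; rewrite lee_fin.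
Qed.

Lemma ess_inf_on_cvg_ae (F : set_system R) {FF : ProperFilter F}
    (i : R -> interval R) (f : R -> R) (l : \bar R) (e : R) :
  (e%:E < l)%E -> ess_inf_on (i t) f @[t --> F] --> l ->
  exists t, {ae mu, forall s, s \in i t -> e <= f s}.
Proof.
move=> el fl; have [t et] : exists t, (e%:E < ess_inf_on (i t) f)%E.
  have /fl : nbhs l [set y | (e%:E < y)%E].
    by apply: open_nbhs_nbhs; split => //; exact: open_ereal_gt_ereal.
  by move=> Ft; have [t et] := @filter_ex _ F FF _ Ft; exists t.
by exists t; apply: ess_inf_on_ae; exact: ltW.
Qed.

End ess_inf_limits.

Section logistic_equation.
Context (R : realType) (g0 nu : R -> R) (kappa lambda : R) (K : R -> R -> R).
Notation mu := (@lebesgue_measure R).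
Hypothesis g0_ge0 : forall t : R, 0 <= g0 t.
Hypothesis lg : loc_integrable g0.
Hypothesis nu_bounded : locally_ess_bounded nu.
Hypothesis nu_le : {ae mu, forall t, nu t <= t}.
Hypothesis kappa_gt0 : 0 < kappa.
Hypothesis lambda_gt0 : 0 < lambda.
Hypothesis K_measurable : lebesgue_measurable2 K.
Hypothesis K_regular : {ae mu, forall t,
  left_continuous (K t) /\ {homo K t : x y / x <= y}}.
Hypothesis mass_bounded : ess_bounded (kernel_mass nu K).

Definition delay_integral (psi : R -> R) t :=
  stieltjes_integral (K t) (nu t) t psi.

Lemma kernel_massE : {ae mu, forall t,
  kernel_mass nu K t = K t t - K t (nu t) /\ 0 <= K t t - K t (nu t)}.
Proof.
apply: filterS2 nu_le K_regular => t nut [lcK ndK]; split.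
  by rewrite /kernel_mass stieltjes_integral_cst// mul1r.
by rewrite subr_ge0 ndK.
Qed.

Lemma logistic_delay_functional :
  exists C, delay_functional nu (kernel_mass nu K) C delay_integral.
Proof.
have [mmass [M massM]] := mass_bounded.
have CM : M <= `|M| + 1 by rewrite (le_trans (ler_norm _))// lerDl.
have massC : {ae mu, forall t, kernel_mass nu K t <= `|M| + 1}.
  by apply: filterS massM => t /(le_trans (ler_norm _))/le_trans; apply.
exists (`|M| + 1); split => //.
- move=> a b; have [N NP] := nu_bounded.2 a b; exists (- N).
  by apply: filterS NP => t /[apply]; rewrite ler_norml => /andP[].
- move=> psi; apply: ae_measurable_delay_integral => //.
  + exact: (ae_measurable_completion nu_bounded.1).
  + by apply: filterS K_regular => t [].
  + by apply: filterS K_regular => t [].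
- apply: filterS2 nu_le K_regular => t nut [lcK ndK] psi1 psi2 c1 c2 le12.
  exact: le_stieltjes_integral.
- apply: filterS2 K_regular (filterI nu_le (filterI massC kernel_massE)).
  move=> t [lcK ndK] [nut [mt [mE m0]]] psi1 psi2 e c1 c2 e0 le12.
  apply: (le_trans (stieltjes_integral_dist ndK lcK nut c1 c2 le12)).
  by rewrite ler_wpM2l// -mE.
- apply: filterS2 K_regular (filterI nu_le kernel_massE).
  move=> t [lcK ndK] [nut [mE _]] c.
  by rewrite mE /delay_integral stieltjes_integral_cst.
Qed.

Lemma logistic_response_law : response_law (response kappa lambda).
Proof.
split; [exact: response_continuous|exact: response_le|exact: response_le1].
Qed.

(** The exponential is Lipschitz on the range of [x] over a segment, so it
    preserves absolute continuity. *)
Lemma exp_global_solution (t0 L : R) (x : R -> R) :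
  continuous x -> loc_integrable (rate g0 delay_integral (response kappa lambda) x) ->
  (forall t, x t = L +
    (primitive (rate g0 delay_integral (response kappa lambda) x) t -
     primitive (rate g0 delay_integral (response kappa lambda) x) t0)) ->
  global_solution g0 nu kappa lambda K (expR \o x).
Proof.
set r := rate _ _ _ _ => cx lr xeq; split.
- move=> a b e e0; have [B BP] := continuous_bounded_segment a b cx.
  have eB : 0 < e / expR B by rewrite divr_gt0// expR_gt0.
  have [d d0 dP] := primitive_ac a b lr eB.
  exists d => // n l u lu disj small.
  have h p q : a <= p <= b -> a <= q <= b ->
      expR (x q) - expR (x p) <= expR B * `|x q - x p|.
    (* e^q - e^p = e^q (1 - e^(p - q)) <= e^q (q - p) *)
    move=> pab qab; have := expR_ge1Dx (x p - x q).
    rewrite expRB => h1.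
    have : expR (x q) * (1 - expR (x p) / expR (x q)) <= expR (x q) * `|x q - x p|.
      rewrite ler_wpM2l ?expR_ge0//; apply: le_trans (ler_norm _).
      by rewrite lerBlDr -lerBlDl; move: h1; rewrite lerBlDl; lra.
    rewrite mulrBr mulr1 mulrCA divff ?gt_eqF ?expR_gt0// mulr1 => /le_trans; apply.
    by rewrite ler_wpM2r// ler_expR (le_trans (ler_norm _))// BP.
  apply: (@le_lt_trans _ _ (\sum_(i < n) expR B * `|primitive r (u i) - primitive r (l i)|)).
    apply: ler_sum => i _; have [al li ub] := lu i.
    have lab : a <= l i <= b by rewrite al (le_trans li).
    have uab : a <= u i <= b by rewrite (le_trans al).
    have -> : primitive r (u i) - primitive r (l i) = x (u i) - x (l i).
      by rewrite xeq [x (l i)]xeq; lra.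
    rewrite ler_norml h// andbT lerNl opprB distrC; exact: h.
  by rewrite -mulr_sumr mulrC -ltr_pdivlMr ?expR_gt0//; exact: dP.
- apply: filterS (primitive_derive lr) => t Dt.
  have Dx : is_derive t (1 : R) x (r t).
    have E : (fun s => (L - primitive r t0) + primitive r s) = x.
      by apply/funext => s; rewrite xeq; lra.
    rewrite -E -[r t]add0r; apply: is_deriveD.
  have := is_derive1_comp (is_derive_expR (x t)) Dx.
  by rewrite /logistic_rhs /r /rate mulrC mulrAC.
Qed.

Lemma clock_cvgNy (C : R) : 0 < C ->
  (exists t1 : R, (\int[mu]_(s in `[t, t1]) (g0 s)%:E)%E @[t --> -oo] --> +oo%E) ->
  clock g0 C t @[t --> -oo] --> -oo.
Proof.
move=> C0 [t1 /cvgeyPge div]; apply/cvgrNyPle => A.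
have {}div := div (primitive g0 t1 - A / C).
near=> t.
have tt1 : t <= t1 by near: t; exact: (nbhs_ninfty_le (num_real t1)).
have : ((primitive g0 t1 - A / C)%:E <= \int[mu]_(s in `[t, t1]) (g0 s)%:E)%E.
  by near: t.
rewrite integral_primitive// lee_fin lerD2l lerN2 /clock primitiveZ// => h.
by rewrite mulrC -ler_pdivlMr.
Unshelve. all: by end_near. Qed.

(** Small increments of [W] on a half-line would make the integrals over
    [omega t, t] small for large [t], as [omega] tends to +oo. *)
Lemma delay_mass_tail (omega : R -> R) :
  loc_integrable (fun t => g0 t * kernel_mass nu K t) ->
  (forall t, omega t <= t) -> omega t @[t --> +oo] --> +oo ->
  (0 < limf_esup (fun t => \int[mu]_(s in `[omega t, t])
        (g0 s * kernel_mass nu K s)%:E) (pinfty_nbhs R))%E ->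
  let W := primitive (fun t => g0 t * kernel_mass nu K t) in
  ~ (forall e, 0 < e -> exists T, forall a b, T <= a -> a <= b -> W b - W a <= e).
Proof.
move=> lgm omt omy + W Wsmall; set l := limf_esup _ _ => l0.
have [e e0 el] : exists2 e : R, 0 < e & (e%:E < l)%E.
  move: l l0 => [l||]//; last by exists 1; rewrite ?ltry.
  by rewrite lte_fin => l0; exists (l / 2); rewrite ?divr_gt0// lte_fin gtr_pMr// invf_lt1// ltr1n.
have [T TP] := Wsmall e e0.
move: el; apply/negP; rewrite -leNgt /l limf_esupE.
pose F t := (\int[mu]_(s in `[omega t, t]) (g0 s * kernel_mass nu K s)%:E)%E.
apply: (@le_trans _ _ (ereal_sup (F @` [set t | T <= omega t]))).
  apply: ereal_inf_lbound; exists [set t | T <= omega t] => //.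
  by move: omy => /cvgryPge/(_ T).
apply: ge_ereal_sup => _ [t /= Tt <-].
by rewrite /F integral_primitive// lee_fin; exact: TP.
Qed.

End logistic_equation.

Theorem theorem6p1 (R : realType) (g0 nu : R -> R) (kappa lambda : R)
    (K : R -> R -> R)
    (g0_ge0 : forall t : R, 0 <= g0 t)
    (g0_int : locally_lebesgue_integrable g0)
    (nu_bounded : locally_ess_bounded nu)
    (nu_le : {ae @lebesgue_measure R, forall t, nu t <= t})
    (kappa_gt0 : 0 < kappa)
    (lambda_gt0 : 0 < lambda)
    (K_measurable : lebesgue_measurable2 K)
    (K_regular : {ae @lebesgue_measure R, forall t,
       [/\ left_continuous (K t),
           {homo K t : x y / x <= y} &
           forall a b : R, bounded_variation a b (K t)]})
    (mass_bounded : ess_bounded (kernel_mass nu K))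
    (g0_div : exists t0 : R,
       (\int[@lebesgue_measure R]_(s in `[t, t0]) (g0 s)%:E)%E @[t --> -oo]
         --> +oo%E)
    (mass_pos : exists2 l : \bar R, (0 < l)%E &
       ess_inf_on `]-oo, t] (kernel_mass nu K) @[t --> -oo] --> l) :
  forall t0 c : R, 0 < c < kappa ->
  exists u : R -> R,
    [/\ [/\ global_solution g0 nu kappa lambda K u,
            positive_function u,
            u t0 = c,
            forall t, t <= t0 -> u t < kappa &
            {ae @lebesgue_measure R, forall t, t <= t0 -> 0 <= derive1 u t}],
        u t @[t --> -oo] --> 0 &
        ess_inf_on `[t, +oo[ nu @[t --> +oo] --> +oo%E ->
        (exists omega : R -> R,
           [/\ continuous omega,
               forall t, omega t <= t,
               omega t @[t --> +oo] --> +oo &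
               (0 < limf_esup
                  (fun t => \int[@lebesgue_measure R]_(s in `[omega t, t])
                              (g0 s * kernel_mass nu K s)%:E)
                  (pinfty_nbhs R))%E]) ->
        oscillates_about_at_pinfty kappa u \/ u t @[t --> +oo] --> kappa].
Proof.
move=> t0 c /andP[c0 ck].
have lg : loc_integrable g0.
  by split; [exact: (ae_measurable_completion g0_int.1)|exact: g0_int.2].
have Kreg : {ae @lebesgue_measure R, forall t,
    left_continuous (K t) /\ {homo K t : x y / x <= y}}.
  by apply: filterS K_regular => t [].
have [C HI] := logistic_delay_functional nu_bounded nu_le K_measurable Kreg
  mass_bounded.
have HPhi := logistic_response_law kappa_gt0 lambda_gt0.
have lnck : ln c < ln kappa by rewrite ltr_ln// posrE// (lt_trans c0).
have Phic : 0 < response kappa lambda (ln c) by exact: response_gt0.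
have Phik := response_ln lambda kappa_gt0.
have [x [xmod xeq xL xnd]] := delay_solution lg g0_ge0 HI HPhi t0 (ltW Phic).
have cx : continuous x := modulus_continuous (clock_continuous (C := C) lg) xmod.
have lr := rate_loc_integrable lg g0_ge0 HI HPhi cx.
have xt0 : x t0 = ln c by rewrite xeq subrr addr0.
have sol := exp_global_solution cx lr xeq.
exists (expR \o x); split; [split|..] => //.
- by move=> t; exact: expR_gt0.
- by rewrite /= xt0 lnK.
- move=> t tt0 /=; rewrite -[ltRHS]lnK ?posrE// ltr_expR.
  exact: le_lt_trans (xL t tt0) lnck.
- have past s : s < t0 -> 0 <= response kappa lambda (x s).
    move=> st0; apply: ltW; apply: response_gt0 => //.
    exact: le_lt_trans (xL s (ltW st0)) lnck.
  apply: filterS2 sol.2 (rate_ge0 g0_ge0 HI HPhi cx past) => t Dt rt tt0.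
  rewrite derive1E (@derive_val _ _ _ _ _ _ _ Dt) /logistic_rhs mulrAC.
  by rewrite mulr_ge0 ?expR_ge0//; exact: rt.
- have [l l0 ml] := mass_pos.
  have [e e0 el] : exists2 e : R, 0 < e & (e%:E < l)%E.
    move: l l0 {ml} => [l||]//; last by exists 1; rewrite ?ltry.
    by rewrite lte_fin => l0; exists (l / 2); rewrite ?divr_gt0// lte_fin gtr_pMr// invf_lt1// ltr1n.
  have [T0 T0P] := ess_inf_on_cvg_ae el ml.
  have em : {ae @lebesgue_measure R, forall t, t <= T0 -> e <= kernel_mass nu K t}.
    by apply: filterS T0P => t + tT0; apply; rewrite in_itv.
  have C0 := delay_bound_gt0 HI.
  have xNy := solution_cvgNy lg g0_ge0 HI HPhi xmod xeq Phic xL e0 em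
    (clock_cvgNy lg C0 g0_div).
  have -> : expR \o x = (fun y => expR (- y)) \o (fun t => - x t).
    by apply/funext => t /=; rewrite opprK.
  apply: (@cvg_comp _ _ _ (fun t => - x t) (fun y => expR (- y)) _ +oo).
    exact/cvgNry.
  exact: cvgr_expR.
move=> nuy [omega [_ omt omy omW]].
have nu_pinfty N : exists T, {ae @lebesgue_measure R, forall t, T <= t -> N <= nu t}.
  have [T TP] := ess_inf_on_cvg_ae (ltry N) nuy; exists T.
  by apply: filterS TP => t + Tt; apply; rewrite in_itv/= Tt.
have lgm : loc_integrable (fun t => g0 t * kernel_mass nu K t).
  apply: (loc_integrable_bound _ lg).
    apply: ae_measurableM; first exact: lg.1.
    exact: (ae_measurable_completion mass_bounded.1).
  have [M MP] := mass_bounded.2; move=> a b; exists M.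
  by apply: filterS MP => t Mt _; rewrite normrM ger0_norm// mulrC ler_wpM2r.
have nW := delay_mass_tail lgm omt omy omW.
(* it remains to treat solutions that stay on one side of [kappa]; above it,
   the argument is applied to [- x] *)
suff : (exists tau, (forall t, tau <= t -> expR (x t) <= kappa) \/
    (forall t, tau <= t -> kappa <= expR (x t))) -> x t @[t --> +oo] --> ln kappa.
  move=> xk; have [/xk xlk|nosc] := pselect (exists tau,
    (forall t, tau <= t -> (expR \o x) t <= kappa) \/
    (forall t, tau <= t -> kappa <= (expR \o x) t)); last by left.
  right; rewrite -[X in _ --> X](lnK (x := kappa)) ?posrE//.
  by apply: (@cvg_comp _ _ _ x expR _ _ _ xlk); exact: continuous_expR.
have up := mass_le_incr lg g0_ge0 HI HPhi xmod xeq nu_pinfty lgm.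
have dn := incr_le_mass lg g0_ge0 HI HPhi xmod xeq nu_pinfty lgm.
have nd := response_law_le HPhi.
move=> [tau [ule|uge]].
- have xk t : tau <= t -> x t <= ln kappa.
    by move=> /ule; rewrite -{1}(lnK (x := kappa)) ?posrE// ler_expR.
  have [|T TP] := up tau 0; first by move=> s /xk/nd; rewrite Phik.
  apply: (monotone_tail_cvg (N := Num.max tau T) _ _ _ nW).
  + by move=> t; rewrite ge_max => /andP[/xk].
  + move=> s t; rewrite ge_max => /andP[_ Ts] st.
    by have := TP s t Ts st; rewrite mul0r subr_ge0.
  + move=> e e0 xe; exists (response kappa lambda (ln kappa - e)).
      by apply: response_gt0 => //; rewrite gtrBl.
    by apply: (up (Num.max tau T)) => s Ns; apply: nd; exact: xe.
- have kx t : tau <= t -> ln kappa <= x t.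
    by move=> /uge; rewrite -{1}(lnK (x := kappa)) ?posrE// ler_expR.
  have [|T TP] := dn tau 0; first by move=> s /kx/nd; rewrite Phik.
  suff : - x t @[t --> +oo] --> - ln kappa.
    have xE : x = (fun t => - - x t) by apply/funext => t; rewrite opprK.
    by move=> xk; rewrite xE -[ln kappa]opprK; exact: (cvgN xk).
  apply: (monotone_tail_cvg (N := Num.max tau T) _ _ _ nW).
  + by move=> t; rewrite ge_max lerN2 => /andP[/kx].
  + move=> s t; rewrite ge_max => /andP[_ Ts] st.
    by have := TP s t Ts st; rewrite mul0r lerN2 subr_le0.
  + move=> e e0 xe; exists (- response kappa lambda (ln kappa + e)).
      by rewrite oppr_gt0; apply: response_lt0 => //; rewrite ltrDl.
    have [|T' T'P] := dn (Num.max tau T) (response kappa lambda (ln kappa + e)).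
      move=> s Ns; apply: nd; have := xe s Ns; rewrite lerNl opprD opprK; lra.
    by exists T' => a b T'a ab; have := T'P a b T'a ab; lra.
Qed.
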